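(* Let $a<b$ be real numbers and let $p\ge 0$ be an integer. There is a constant $C_2>0$ such that for every positive integer $N$, with $h=(b-a)/N$ and uniform partition $x_i=a+ih$ ($0\le i\le N$), every $u\in H^{p+1}(a,b)$, and every function $u^R$ that is a (possibly discontinuous) piecewise polynomial of degree at most $p$ on this partition, $$\|u-u^R\|_{L^2(a,b)}\ \ge\ h^{p+1}\left[\sqrt{\sum_{i=1}^{N-1} h\,Q(D_i^0,D_i^1,\dots,D_i^p)}\;-\;C_2\,|u|_{H^{p+1}(a,b)}\right],$$ where the numbers $D_i^k$ are the scaled derivative jumps of $u^R$ at $x_i$ and $Q$ is the quadratic form, both defined in the context. The constant $C_2$ is independent of $h$, $u$ and $u^R$.
   Context: Fix an integer $p\ge 0$ and let $\mathcal P$ be the space of real polynomials in one variable of degree at most $p$. For the uniform partition $a=x_0<x_1<\dots<x_N=b$ with $x_{i+1}-x_i=h=(b-a)/N$, let $\mathcal P_h$ be the space of functions whose restriction to each open cell $(x_i,x_{i+1})$ is a polynomial of degree at most $p$ (no continuity is required at the nodes). For $u^R\in\mathcal P_h$, $1\le i\le N-1$ and $0\le k\le p$, define the one-sided derivative values $$M_i^k=\frac{d^k}{dx^k}u^R(x_i^+),\qquad L_i^k=\frac{d^k}{dx^k}u^R(x_i^-),$$ the jumps $J_i^k=M_i^k-L_i^k$, and the scaled jumps $$D_i^k=J_i^k/h^{p+1-k}.$$ In $D^k$, $D_i^k$, etc., the superscript $k$ is an index, not a power. For real numbers $D^0,D^1,\dots,D^p$ define $$Q(D^0,D^1,\dots,D^p)=\min_{\hat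 v\in\mathcal P}\left(\left\|\hat v+\frac12\sum_{k=0}^p\frac{D^k}{k!}\xi^k\right\|^2_{L^2(-\frac12,0)}+\left\|\hat v-\frac12\sum_{k=0}^p\frac{D^k}{k!}\xi^k\right\|^2_{L^2(0,\frac12)}\right),$$ where $\xi$ is the variable of the polynomials. $H^{p+1}(a,b)=W^{p+1}_2(a,b)$ is the standard Sobolev space, and $|u|_{H^{p+1}(a,b)}$ is its seminorm, i.e. the $L^2(a,b)$ norm of the (weak) derivative of $u$ of order $p+1$. *)

(* Defs.v *)
From HB Require Import structures.
From mathcomp Require Import all_boot all_order all_algebra.
From mathcomp Require Import all_classical all_reals all_analysis.

Set Implicit Arguments.
Unset Strict Implicit.
Unset Printing Implicit Defensive.

Import Order.TTheory GRing.Theory Num.Theory.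
Import numFieldNormedType.Exports.

Local Open Scope classical_set_scope.
Local Open Scope ring_scope.

(* Functions on an interval ]a, b[ are represented by total functions R -> R
   whose values outside ]a, b[ are never used: [f \_ A] is [f] on [A] and 0
   elsewhere. *)
Definition L2 (R : realType) (a b : R) : set (R -> R) :=
  [set f | (f \_ `]a, b[) \in Lfun (@lebesgue_measure R) 2%:E].

Definition L2norm (R : realType) (a b : R) (f : R -> R) : R :=
  fine ('N[@lebesgue_measure R]_2%:E [EFin \o (f \_ `]a, b[)])%E.

(* C_c^oo(a, b) *)
Definition test_function (R : realType) (a b : R) (phi : R -> R) : Prop :=
  [/\ forall (k : nat) (x : R), derivable (derive1n k phi) x 1,
      compact (closure [set x | phi x != 0]) &
      closure [set x | phi x != 0] `<=` `]a, b[].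

(* The set of (representatives of) the L^2 weak derivatives of order k of u
   on ]a, b[; any two elements agree almost everywhere on ]a, b[. *)
Definition weak_derivatives (R : realType) (a b : R) (k : nat) (u : R -> R) :
    set (R -> R) :=
  [set g | L2 a b g /\
    forall phi : R -> R, test_function a b phi ->
      \int[@lebesgue_measure R]_(x in `]a, b[) (u x * derive1n k phi x) =
      (-1) ^+ k * \int[@lebesgue_measure R]_(x in `]a, b[) (g x * phi x)].

Definition weak_derivative (R : realType) (a b : R) (k : nat) (u : R -> R) :
    R -> R :=
  xget (cst 0) (weak_derivatives a b k u).

Definition sobolevH (R : realType) (a b : R) (m : nat) : set (R -> R) :=
  [set u | L2 a b u /\
    forall k : nat, (k <= m)%N -> weak_derivatives a b k u !=set0].

Definition sobolev_seminorm (R : realType) (a b : R) (m : nat) (u : R -> R) :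
    R :=
  L2norm a b (weak_derivative a b m u).

Definition mesh (R : realType) (a b : R) (N : nat) : R := (b - a) / N%:R.

Definition node (R : realType) (a b : R) (N i : nat) : R :=
  a + i%:R * mesh a b N.

(* No condition on the values at the nodes. *)
Definition piecewise_poly (R : realType) (a b : R) (p N : nat) :
    set (R -> R) :=
  [set w | forall i : nat, (i < N)%N ->
    exists2 q : {poly R}, (size q <= p.+1)%N &
      {in `]node a b N i, node a b N i.+1[, forall x, w x = q.[x]}].

Definition right_deriv (R : realType) (w : R -> R) (k : nat) (x : R) : R :=
  lim (derive1n k w y @[y --> x^'+]).

Definition left_deriv (R : realType) (w : R -> R) (k : nat) (x : R) : R :=
  lim (derive1n k w y @[y --> x^'-]).

Definition jump (R : realType) (w : R -> R) (k : nat) (x : R) : R :=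
  right_deriv w k x - left_deriv w k x.

Definition scaled_jump (R : realType) (a b : R) (p N : nat) (w : R -> R)
    (i k : nat) : R :=
  jump w k (node a b N i) / mesh a b N ^+ (p.+1 - k).

Definition jump_poly (R : realType) (p : nat) (D : 'I_p.+1 -> R) : {poly R} :=
  2^-1 *: \sum_(k < p.+1) (D k / k`!%:R) *: 'X^k.

(* The minimum over the finite-dimensional space of polynomials of degree at
   most p of a nonnegative (hence bounded below) quantity; it is attained, so
   it is the infimum. *)
Definition Q (R : realType) (p : nat) (D : 'I_p.+1 -> R) : R :=
  inf [set r : R | exists2 v : {poly R}, (size v <= p.+1)%N &
    r = L2norm (- 2^-1) 0 (horner (v + jump_poly D)) ^+ 2
      + L2norm 0 2^-1 (horner (v - jump_poly D)) ^+ 2].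

(* Main.v *)
Require Import Defs.
From HB Require Import structures.
From mathcomp Require Import all_boot all_order all_algebra.
From mathcomp Require Import all_classical all_reals all_analysis.
From mathcomp Require Import measurable_realfun ring lra.

(* Around each interior node x_i take the cell of length h centred at x_i. On it
   the distance from u^R to u is bounded below by duality: test against
   psi = rho (u^R - v), where rho is a smooth cutoff that vanishes near the
   centre and the ends of the cell and is close to 1 elsewhere, and v is the
   rho-weighted L^2 projection of u^R on the polynomials of degree at most p.
   Then psi is smooth (u^R is a polynomial wherever rho does not vanish) and
   orthogonal to these polynomials, so psi is the derivative of order p + 1 of
   a test function phi supported in the cell, with
   |phi| <= h^(p+1) |psi| in L^2. With q = int rho (u^R - v)^2 one has
   int u^R psi = q and |psi|^2 <= q, while
   int u psi = +- int u^(p+1) phi, whence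
   sqrt q <= |u - u^R| + h^(p+1) |u^(p+1)| on the cell. As rho increases to 1,
   q is bounded below by the unweighted squared distance of u^R to the
   polynomials, which scales to h^(2p+3) Q. The l^2 sum over the cells gives
   the theorem with C_2 = 1; no approximation theory for u is needed. *)

Set Implicit Arguments.
Unset Strict Implicit.
Unset Printing Implicit Defensive.

Import Order.TTheory GRing.Theory Num.Theory.
Import numFieldNormedType.Exports.

Local Open Scope classical_set_scope.
Local Open Scope ring_scope.

(** * Smooth functions *)

Definition smooth {R : realType} (f : R -> R) : Prop :=
  forall (k : nat) (x : R), derivable (derive1n k f) x 1.

(** Finite-order version of [smooth], recursive on the first derivative, so that closure under sums
    and products can be proved by induction on the order. *)
Fixpoint nderivable {R : realType} (n : nat) (f : R -> R) : Prop :=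
  if n is m.+1 then (forall x, derivable f x 1) /\ nderivable m (derive1 f)
  else True.

Lemma derive1n_derive1 {R : realType} (k : nat) (f : R -> R) :
  derive1n k (derive1 f) = derive1n k.+1 f.
Proof. by rewrite /derive1n iterSr. Qed.

Lemma nderivableP {R : realType} (n : nat) (f : R -> R) :
  nderivable n f <-> forall k x, (k < n)%N -> derivable (derive1n k f) x 1.
Proof.
elim: n f => [|n IH] f /=; first by split.
split=> [[df /IH h] [|k] x kn|h].
- exact: df.
- by rewrite -derive1n_derive1; exact: h.
- split; first by move=> x; exact: (h 0%N).
  by apply/IH => k x kn; rewrite derive1n_derive1; exact: h.
Qed.

Lemma smoothP {R : realType} (f : R -> R) : smooth f <-> forall n, nderivable n f.
Proof.
split=> [sf n|h k x]; first by apply/nderivableP => k x _; exact: sf.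
by have /nderivableP := h k.+1; exact.
Qed.

Lemma nderivableW {R : realType} (n : nat) (f : R -> R) :
  nderivable n.+1 f -> nderivable n f.
Proof. by rewrite !nderivableP => h k x kn; apply: h; exact: ltnW. Qed.

Lemma nderivableS {R : realType} (n : nat) (f f' : R -> R) :
  (forall x : R, is_derive x 1 f (f' x)) -> nderivable n f' -> nderivable n.+1 f.
Proof.
move=> df cf'; split=> [x|]; first exact: ex_derive.
suff -> : (derive1 f) = f' by [].
by apply/funext => x; rewrite derive1E; exact: derive_val.
Qed.

Lemma is_derive_derive1 {R : realType} (f : R -> R) (x : R) :
  derivable f x 1 -> is_derive x 1 f (derive1 f x).
Proof. by move=> df; rewrite derive1E; exact: derivableP. Qed.

(** A derivative that stays in [S] can be differentiated again. Polynomials, affine substitutions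
    and the [flat] family are all handled by exhibiting such a class. *)
Lemma smooth_coind {R : realType} (S : set (R -> R)) :
  (forall f, S f -> exists2 f', S f' & forall x : R, is_derive x 1 f (f' x)) ->
  forall f, S f -> smooth f.
Proof.
move=> h f Sf; apply/smoothP => n; elim: n f Sf => [//|n IH] f /h[f' Sf' df].
exact/(nderivableS df)/IH.
Qed.

Lemma smooth_derivable {R : realType} (f : R -> R) :
  smooth f -> forall x, derivable f x 1.
Proof. by move=> sf; exact: (sf 0%N). Qed.

Lemma smooth_derive1 {R : realType} (f : R -> R) : smooth f -> smooth (derive1 f).
Proof. by move=> sf k x; rewrite derive1n_derive1; exact: sf. Qed.

Lemma smooth_antiderivative {R : realType} (F f : R -> R) :
  (forall x : R, is_derive x 1 F (f x)) -> smooth f -> smooth F.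
Proof.
move=> dF sf; apply/smoothP => -[//|n]; apply: (nderivableS dF).
by move/smoothP : sf.
Qed.

Lemma smooth_continuous {R : realType} (f : R -> R) : smooth f -> continuous f.
Proof.
move=> sf x; apply: differentiable_continuous.
exact/derivable1_diffP/smooth_derivable.
Qed.

Lemma nderivableD {R : realType} n (f g : R -> R) :
  nderivable n f -> nderivable n g -> nderivable n (f \+ g).
Proof.
elim: n f g => [//|n IH] f g [df cf] [dg cg].
apply: (@nderivableS _ _ _ ((derive1 f) \+ (derive1 g))); last exact: IH.
by move=> x; apply: is_deriveD; exact/is_derive_derive1.
Qed.

Lemma nderivableM {R : realType} n (f g : R -> R) :
  nderivable n f -> nderivable n g -> nderivable n (f \* g).
Proof.
elim: n f g => [//|n IH] f g cf cg.
have [[df cf'] [dg cg']] := (cf, cg).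
apply: (@nderivableS _ _ _ ((f \* (derive1 g)) \+ ((derive1 f) \* g))).
  move=> x; have := is_deriveM (is_derive_derive1 (df x)) (is_derive_derive1 (dg x)).
  by rewrite /GRing.scale/= [g x * _]mulrC.
(* The undifferentiated factors reappear in the product rule; their order is lowered to fit the
   induction hypothesis. *)
by apply: nderivableD; apply: IH => //; exact: nderivableW.
Qed.

Lemma smoothD {R : realType} (f g : R -> R) :
  smooth f -> smooth g -> smooth (f \+ g).
Proof.
by move=> /smoothP sf /smoothP sg; apply/smoothP => n; exact: nderivableD.
Qed.

Lemma smoothM {R : realType} (f g : R -> R) :
  smooth f -> smooth g -> smooth (f \* g).
Proof.
by move=> /smoothP sf /smoothP sg; apply/smoothP => n; exact: nderivableM.
Qed.

Lemma smooth_horner {R : realType} (p : {poly R}) : smooth (horner p).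
Proof.
apply: (@smooth_coind _ [set f | exists q : {poly R}, f = horner q]).
  by move=> _ [q ->]; exists (horner q^`()); [exists q^`()|move=> x; exact: is_derive_poly].
by exists p.
Qed.

Lemma smooth_affine {R : realType} (f : R -> R) (k c : R) :
  smooth f -> smooth (fun x => f (k * x + c)).
Proof.
(* The scalar [e] absorbs the factor [k] that the chain rule produces at each differentiation. *)
pose S := [set h : R -> R | exists2 g, smooth g &
  exists e, h = fun x => e * g (k * x + c)].
move=> sf; apply: (@smooth_coind _ S); last first.
  by exists f => //; exists 1; apply/funext => x; rewrite mul1r.
move=> _ [g sg [e ->]]; exists (fun x => (e * k) * (derive1 g) (k * x + c)).
  by exists (derive1 g); [exact: smooth_derive1|exists (e * k)].
move=> x.
have aff : is_derive x 1 (fun x => k * x + c) k.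
  have := is_derive_poly (k *: 'X + c%:P) x.
  rewrite derivD derivC derivZ derivX addr0 hornerZ hornerC mulr1.
  by congr is_derive; apply/funext => y; rewrite !hornerE.
have dg : is_derive (k * x + c) 1 g (derive1 g (k * x + c)).
  exact/is_derive_derive1/smooth_derivable.
have h := is_derive1_comp (g := fun x => k * x + c) dg aff.
have -> : e * k * derive1 g (k * x + c) = e *: (derive1 g (k * x + c) * k).
  by rewrite /GRing.scale/= -mulrA [k * _]mulrC.
exact: (is_deriveZ e h).
Qed.

(** * A flat function and smooth cutoffs *)

(** The bound forces [f 0 = 0], and the difference quotient at 0 is then at most [K * |t|] in
    absolute value. *)
Lemma is_derive0_quadratic {R : realType} (f : R -> R) (K : R) :
  (forall x, `|f x| <= K * x ^+ 2) -> is_derive (0 : R) 1 f 0.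
Proof.
move=> h.
have f0 : f 0 = 0.
  by apply/eqP; rewrite -normr_le0 (le_trans (h 0))// expr0n/= mulr0.
have K0 : 0 <= K by have := h 1; rewrite expr1n mulr1; exact: le_trans.
suff cf : (fun t : R => t^-1 *: (f (t *: 1 + 0) - f 0)) @ 0^' --> (0 : R).
  apply: DeriveDef; first by apply/cvg_ex; exists 0.
  exact: (cvg_lim _ cf).
apply/cvgrPdist_le => e e0.
near=> t.
have t0 : t != 0 by near: t; exact: nbhs_dnbhs_neq.
rewrite f0 subr0 sub0r normrN addr0 /GRing.scale/= mulr1 normrM normfV.
rewrite mulrC ler_pdivrMr ?normr_gt0//.
rewrite (le_trans (h t))// -real_normK ?num_real//.
rewrite expr2 mulrA ler_wpM2r//.
have te : `|t| <= e / (K + 1).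
  by near: t; apply: dnbhs0_le; rewrite divr_gt0// ltr_wpDl.
rewrite ler_pdivlMr ?ltr_wpDl// in te.
by apply: le_trans te; rewrite mulrDr mulr1 mulrC lerDl.
Unshelve. all: by end_near. Qed.

(** [P = 1] gives the classical flat function exp(-1/x). The polynomial factor in 1/x makes the
    family closed under differentiation. *)
Definition flat {R : realType} (P : {poly R}) (x : R) : R :=
  if 0 < x then P.[x^-1] * expR (- x^-1) else 0.

(** The quotient y^(n+1) / (n+1)! is one term of the exponential series of y. *)
Lemma expR_ge_pow {R : realType} (n : nat) (y : R) : 0 <= y ->
  y ^+ n.+1 * expR (- y) <= (n.+1)`!%:R.
Proof.
move=> y0; rewrite expRN ler_pdivrMr ?expR_gt0// mulrC -ler_pdivrMr.
  by apply: le_trans (expR_ge1Dxn n y0); rewrite ler_wpDl.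
by rewrite ltr0n fact_gt0.
Qed.

(** With y = 1/x, y^i exp(-y) = x^2 y^(i+2) exp(-y), and [expR_ge_pow] bounds y^(i+2) exp(-y) by
    (i+2)!. This is what gives the derivative 0 at the origin. *)
Lemma flat_quadratic {R : realType} (P : {poly R}) :
  exists K, forall x, `|flat P x| <= K * x ^+ 2.
Proof.
exists (\sum_(i < size P) `|P`_i| * (i.+2)`!%:R) => x.
rewrite /flat; case: ifPn => [x0|_]; last first.
  by rewrite normr0 mulr_ge0 ?sqr_ge0// sumr_ge0// => i _; rewrite mulr_ge0.
rewrite horner_coef mulr_suml mulr_suml.
rewrite (le_trans (ler_norm_sum _ _ _))// ler_sum// => i _.
rewrite -!mulrA normrM ler_wpM2l//.
have y0 : 0 <= x^-1 by rewrite invr_ge0 ltW.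
rewrite ger0_norm ?mulr_ge0 ?expR_ge0 ?exprn_ge0//.
have -> : x^-1 ^+ i = x^-1 ^+ i.+2 * x ^+ 2.
  by rewrite -addn2 exprD -mulrA -exprMn mulVf ?gt_eqF// expr1n mulr1.
by rewrite -mulrA [x ^+ 2 * _]mulrC mulrA ler_wpM2r ?sqr_ge0// expR_ge_pow.
Qed.

(** For x > 0 and y = 1/x one has dy/dx = -y^2, so P(y) exp(-y) has derivative y^2 (P - P')(y)
    exp(-y). *)
Lemma is_derive_flat {R : realType} (P : {poly R}) (x : R) :
  is_derive x 1 (flat P) (flat ('X^2 * (P - P^`())) x).
Proof.
have [x0|x0|->] := ltgtP x 0.
- rewrite {2}/flat ltNge (ltW x0)/=.
  apply: (@near_eq_is_derive _ _ _ (cst (0 : R))).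
    near=> y; rewrite /flat ltNge.
    suff -> : y <= 0 by [].
    by apply: ltW; near: y; exact: lt_nbhsl.
- rewrite {2}/flat x0.
  have x1 : x != 0 by rewrite gt_eqF.
  have dV : is_derive x 1 (fun y : R => y^-1) (- x ^- 2).
    have := @is_deriveV R id x 1 1 x1 (is_derive_id x 1).
    by rewrite /GRing.scale/= mulr1.
  have dP := is_derive1_comp (is_derive_poly P x^-1) dV.
  have dN : is_derive x 1 (fun y : R => - y^-1) (- - x ^- 2).
    exact: is_deriveN dV.
  have dE := is_derive1_comp (g := fun y : R => - y^-1)
    (is_derive_expR (- x^-1)) dN.
  have := is_deriveM dP dE; rewrite /GRing.scale/= => dPE.
  have -> : ('X^2 * (P - P^`())).[x^-1] * expR (- x^-1) =
      P.[x^-1] * (expR (- x^-1) * - - x ^- 2) +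
      expR (- x^-1) * (P^`().[x^-1] * - x ^- 2).
    by rewrite hornerM hornerXn hornerD hornerN exprVn; ring.
  apply: near_eq_is_derive dPE.
  near=> y; rewrite /flat.
  suff -> : 0 < y by [].
  by near: y; exact: lt_nbhsr.
- rewrite {2}/flat ltxx; have [K hK] := flat_quadratic P.
  exact: is_derive0_quadratic hK.
Unshelve. all: by end_near. Qed.

Lemma smooth_flat {R : realType} (P : {poly R}) : smooth (flat P).
Proof.
apply: (@smooth_coind _ [set f | exists q : {poly R}, f = flat q]); last by exists P.
move=> _ [q ->]; exists (flat ('X^2 * (q - q^`()))); first by exists ('X^2 * (q - q^`())).
by move=> x; exact: is_derive_flat.
Qed.

(* [cutoff l a b] increases to the indicator of ]a, b[ as [l] goes to infinity. *)
Definition cutoff {R : realType} (l a b : R) (x : R) : R :=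
  flat 1 (l * (x - a)) * flat 1 (l * (b - x)).

Lemma flat1_ge0 {R : realType} (x : R) : 0 <= flat 1 x.
Proof. by rewrite /flat; case: ifP => // _; rewrite hornerC mul1r expR_ge0. Qed.

Lemma flat1_le1 {R : realType} (x : R) : flat 1 x <= 1.
Proof.
rewrite /flat; case: ifP => // x0.
by rewrite hornerC mul1r expR_le1 oppr_le0 invr_ge0 ltW.
Qed.

Lemma flat1_ge {R : realType} (x : R) : 0 < x -> 1 - x^-1 <= flat 1 x.
Proof. by move=> x0; rewrite /flat x0 hornerC mul1r expR_ge1Dx. Qed.

Lemma smooth_cutoff {R : realType} (l a b : R) : smooth (cutoff l a b).
Proof.
have := smoothM (smooth_affine (k := l) (c := - l * a) (smooth_flat (P := 1)))
                (smooth_affine (k := - l) (c := l * b) (smooth_flat (P := 1))).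
congr smooth; apply/funext => x; rewrite /cutoff/=.
by congr (flat _ _ * flat _ _); ring.
Qed.

Lemma cutoff_ge0 {R : realType} (l a b x : R) : 0 <= cutoff l a b x.
Proof. by rewrite mulr_ge0 ?flat1_ge0. Qed.

Lemma cutoff_le1 {R : realType} (l a b x : R) : cutoff l a b x <= 1.
Proof. by rewrite mulr_ile1 ?flat1_ge0 ?flat1_le1. Qed.

Lemma cutoff_eq0 {R : realType} (l a b x : R) : 0 < l ->
  x \notin `]a, b[ -> cutoff l a b x = 0.
Proof.
move=> l0; rewrite in_itv/= negb_and -!leNgt /cutoff /flat.
case/orP => h.
- by rewrite pmulr_rgt0// subr_gt0 ltNge h/= mul0r.
- by rewrite [X in _ * X]ifF ?mulr0// pmulr_rgt0// subr_gt0 ltNge h.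
Qed.

(** Both factors are at most 1 and, as exp(-t) >= 1 - t, at least 1 - 1/(l e); moreover u v >= u + v
    - 1 for u, v <= 1. *)
Lemma cutoff_ge {R : realType} (l a b e x : R) : 0 < l -> 0 < e ->
  a + e <= x <= b - e -> 1 - 2 / (l * e) <= cutoff l a b x.
Proof.
move=> l0 e0 /andP[h1 h2].
have le0 : 0 < l * e by rewrite mulr_gt0.
have aux t : e <= t -> 1 - (l * e)^-1 <= flat 1 (l * t).
  move=> et; have lt0 : 0 < l * t by rewrite mulr_gt0// (lt_le_trans e0).
  apply: le_trans (flat1_ge lt0); rewrite lerD2l lerN2 lef_pV2 ?posrE//.
  by rewrite ler_pM2l.
have := aux (x - a); rewrite lerBrDl => /(_ h1) A.
have := aux (b - x); rewrite lerBrDr -lerBrDl => B.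
have {}B : 1 - (l * e)^-1 <= flat 1 (l * (b - x)) by apply: B; lra.
have := flat1_le1 (l * (x - a)); have := flat1_le1 (l * (b - x)).
rewrite /cutoff; move: A B; set u := flat _ _; set v := flat _ _.
by set w := (l * e)^-1 => *; nra.
Qed.

(** * Linear functionals on polynomials of bounded degree *)

(* The kernel of the Gram matrix of [L (s * t)] is trivial by positivity, so the
   matrix is invertible. *)
Lemma poly_riesz {R : realFieldType} (n : nat) (L F : {poly R} -> R) :
  linear_for *%R L -> linear_for *%R F ->
  (forall s : {poly R}, (size s <= n)%N -> s != 0 -> 0 < L (s * s)) ->
  exists2 v : {poly R}, (size v <= n)%N &
    forall s : {poly R}, (size s <= n)%N -> L (v * s) = F s.
Proof.
move=> linL linF.
pose Lm := GRing.isLinear.Build R {poly R} R *%R L linL.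
pose Fm := GRing.isLinear.Build R {poly R} R *%R F linF.
pose L' : {linear {poly R} -> R | *%R} := HB.pack L Lm.
pose F' : {linear {poly R} -> R | *%R} := HB.pack F Fm.
rewrite -[L]/(L' : _ -> _) -[F]/(F' : _ -> _).
move: L' F' => {linL linF Lm Fm}{}L {}F Lpos.
pose G : 'M[R]_n := \matrix_(i, j) L ('X^i * 'X^j).
have rowP (c : 'rV[R]_n) j : (c *m G) 0 j = L (rVpoly c * 'X^j).
  rewrite mxE /rVpoly poly_def mulr_suml linear_sum; apply: eq_bigr => i _.
  rewrite mxE -scalerAl linearZ/=; congr (_ * _).
  by rewrite valK.
have expand (s : {poly R}) : (size s <= n)%N -> s = \sum_(j < n) s`_j *: 'X^j.
  move=> sn; rewrite -poly_def; apply/polyP => k; rewrite coef_poly.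
  by case: ltnP => // nk; rewrite nth_default// (leq_trans sn).
have LrV (c : 'rV[R]_n) (s : {poly R}) : (size s <= n)%N ->
    L (rVpoly c * s) = \sum_(j < n) s`_j * (c *m G) 0 j.
  move=> sn; rewrite {1}(expand _ sn) mulr_sumr linear_sum; apply: eq_bigr => j _.
  by rewrite -scalerAr linearZ/= rowP.
have Gu : G \in unitmx.
  rewrite -row_free_unit -kermx_eq0; apply/eqP/row_matrixP => i; rewrite row0.
  set c := row i _.
  have cG : c *m G = 0 by apply/sub_kermxP/row_sub.
  have := LrV c (rVpoly c) (size_poly _ _).
  rewrite cG big1 => [h|j _]; last by rewrite mxE mulr0.
  (* [L] vanishes at the square of the polynomial of the kernel row [c], so positivity forces this
     polynomial to be 0. *)
  have [/(congr1 (@poly_rV _ n))|] := eqVneq (rVpoly c) 0.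
    by rewrite rVpolyK linear0.
  by move/(Lpos _ (size_poly _ _)); rewrite h ltxx.
pose f : 'rV[R]_n := \row_j F 'X^j.
exists (rVpoly (f *m invmx G)); first exact: size_poly.
move=> s sn; rewrite LrV// mulmxKV// [in RHS](expand _ sn) linear_sum.
by apply: eq_bigr => j _; rewrite mxE linearZ.
Qed.

(** * Square integrable functions on intervals *)

Section itv_integrals.
Context {R : realType}.
Notation mu := (@lebesgue_measure R).
Implicit Types (f g : R -> R) (a b c : R).

Lemma integrableEZ A k f : measurable A -> mu.-integrable A (EFin \o f) ->
  mu.-integrable A (EFin \o (fun x => k * f x)).
Proof.
move=> mA fi; have := integrableZl mA k fi.
by apply: eq_integrable => // x _ /=; rewrite EFinM.
Qed.

Lemma integrableED A f g : measurable A -> mu.-integrable A (EFin \o f) ->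
  mu.-integrable A (EFin \o g) ->
  mu.-integrable A (EFin \o (fun x => f x + g x)).
Proof.
move=> mA fi gi; have := integrableD mA fi gi.
by apply: eq_integrable => // x _ /=; rewrite EFinD.
Qed.

Lemma continuous_integrable_oo f a b : continuous f ->
  mu.-integrable `]a, b[ (EFin \o f).
Proof.
move=> cf; apply: (@integrableS _ _ _ mu `[a, b]) => //.
  exact: subset_itv_oo_cc.
apply: continuous_compact_integrable; first exact: segment_compact.
exact: continuous_subspaceT.
Qed.

Lemma continuous_integrable_cc f a b : continuous f ->
  mu.-integrable `[a, b] (EFin \o f).
Proof.
move=> cf; apply: continuous_compact_integrable; first exact: segment_compact.
exact: continuous_subspaceT.
Qed.

Lemma Rintegral_oo_cc f a b : continuous f ->
  \int[mu]_(x in `]a, b[) f x = \int[mu]_(x in `[a, b]) f x.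
Proof.
move=> cf; rewrite Rintegral_itv_obnd_cbnd; last exact: continuous_integrable_oo.
rewrite Rintegral_itv_bndo_bndc//.
apply: integrableS (continuous_integrable_cc a b cf) => //.
exact: subset_itv_co_cc.
Qed.

Lemma Rintegral_oo_split f a c b : a <= c -> c <= b -> 
  mu.-integrable `]a, b[ (EFin \o f) ->
  \int[mu]_(x in `]a, b[) f x =
  \int[mu]_(x in `]a, c[) f x + \int[mu]_(x in `]c, b[) f x.
Proof.
move=> ac cb fi.
have [->|ac'] := eqVneq a c.
  by rewrite set_itvoo0 Rintegral_set0 add0r.
have [<-|bc'] := eqVneq c b.
  by rewrite set_itvoo0 Rintegral_set0 addr0.
have h := @Rintegral_itvB _ f (BRight a) (BLeft b) c fi.
rewrite -h ?bnd_simp// ?lt_neqAle ?ac' ?ac ?bc' ?cb//.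
rewrite -Rintegral_itv_bndo_bndc; last first.
  by apply: integrableS fi => //; apply: subset_itvl; rewrite bnd_simp.
by rewrite addrC subrK.
Qed.

Definition sqint (A : set R) f : Prop :=
  measurable_fun A f /\ mu.-integrable A (EFin \o (fun x => f x ^+ 2)).

Lemma sqintM A f g : measurable A -> sqint A f -> sqint A g ->
  mu.-integrable A (EFin \o (fun x => f x * g x)).
Proof.
move=> mA [mf If] [mg Ig].
apply: le_integrable (integrableED mA If Ig) => //.
  by apply/measurable_EFinP; exact: measurable_funM.
move=> x _ /=; rewrite lee_fin [leRHS]ger0_norm; last first.
  by rewrite addr_ge0 ?sqr_ge0.
rewrite normrM -(real_normK (num_real (f x))) -(real_normK (num_real (g x))).
by nra.
Qed.

Lemma sqintD A f g : measurable A -> sqint A f -> sqint A g ->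
  sqint A (f \+ g).
Proof.
move=> mA sf sg; have [mf If] := sf; have [mg Ig] := sg.
split; first exact: measurable_funD.
have := integrableED mA (integrableED mA If Ig) (integrableEZ 2 mA (sqintM mA sf sg)).
by apply: eq_integrable => // x _ /=; congr EFin; ring.
Qed.

Lemma sqintZ A f k : measurable A -> sqint A f -> sqint A (fun x => k * f x).
Proof.
move=> mA [mf If]; split; first exact: measurable_funM.
have := integrableEZ (k ^+ 2) mA If.
by apply: eq_integrable => // x _ /=; rewrite exprMn.
Qed.

Lemma sqintB A f g : measurable A -> sqint A f -> sqint A g ->
  sqint A (f \- g).
Proof.
move=> mA sf sg; have := sqintD mA sf (sqintZ (-1) mA sg).
by congr (sqint A); apply/funext => x /=; rewrite mulN1r.
Qed.

Lemma sqintS A B f : measurable A -> measurable B -> A `<=` B ->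
  sqint B f -> sqint A f.
Proof.
move=> mA mB AB [mf If]; split; first exact: measurable_funS mf.
exact: integrableS If.
Qed.

Lemma eq_sqint A f g : measurable A -> {in A, f =1 g} -> sqint A f -> sqint A g.
Proof.
move=> mA fg [mf If]; split; first exact: eq_measurable_fun mf.
by apply: eq_integrable If => // x xA /=; rewrite fg.
Qed.

Lemma sqint_continuous f a b : continuous f -> sqint `]a, b[ f.
Proof.
move=> cf; split.
  apply: measurable_funTS; exact: continuous_measurable_fun.
apply: continuous_integrable_oo => x.
by apply: (@continuous_comp _ _ _ f (fun y => y ^+ 2)); [exact: cf|exact: exprn_continuous].
Qed.

(** The integral of (s f + t g)^2 is a nonnegative quadratic form in (s, t); it is evaluated at
    well-chosen points. *)
Lemma sqint_CS A f g : measurable A -> sqint A f -> sqint A g ->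
  (\int[mu]_(x in A) (f x * g x)) ^+ 2 <=
  (\int[mu]_(x in A) f x ^+ 2) * \int[mu]_(x in A) g x ^+ 2.
Proof.
move=> mA sf sg; have [mf If] := sf; have [mg Ig] := sg.
set a := \int[mu]_(x in A) f x ^+ 2; set b := \int[mu]_(x in A) g x ^+ 2.
set c := \int[mu]_(x in A) _.
have a0 : 0 <= a by apply: Rintegral_ge0 => x _; exact: sqr_ge0.
have quad s t : 0 <= s ^+ 2 * a + (2 * s * t) * c + t ^+ 2 * b.
  suff -> : s ^+ 2 * a + (2 * s * t) * c + t ^+ 2 * b =
      \int[mu]_(x in A) (s * f x + t * g x) ^+ 2.
    by apply: Rintegral_ge0 => x _; exact: sqr_ge0.
  have Ifg := sqintM mA sf sg.
  have I1 := integrableEZ (s ^+ 2) mA If.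
  have I2 := integrableEZ (2 * s * t) mA Ifg.
  have I3 := integrableEZ (t ^+ 2) mA Ig.
  rewrite -!RintegralZl// -RintegralD// -RintegralD//; last exact: integrableED.
  by apply: eq_Rintegral => x _; ring.
have [a0'|a0'] := eqVneq a 0.
  (* When a = 0, the point (-(b+1), c) gives -(b+2) c^2 >= 0 with b >= 0, hence c = 0. *)
  have := quad (- c * (b + 1)) (c ^+ 2); have := quad (-(b+1)) c; have := quad 0 1.
  rewrite a0'; nra.
have := quad c (- a); have : 0 < a by rewrite lt_neqAle eq_sym a0' a0.
move=> ap; have -> : c ^+ 2 * a + 2 * c * - a * c + (- a) ^+ 2 * b =
   a * (a * b - c ^+ 2) by ring.
by rewrite pmulr_rge0// subr_ge0.
Qed.

End itv_integrals.

(** * Iterated antiderivatives *)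

Section antiderivative.
Context {R : realType}.
Notation mu := (@lebesgue_measure R).
Implicit Types (f g psi phi : R -> R) (a b c : R) (s : {poly R}).

Lemma subset_Rintegral (A B : set R) f : measurable A -> measurable B ->
  A `<=` B -> mu.-integrable B (EFin \o f) -> (forall x, B x -> 0 <= f x) ->
  \int[mu]_(x in A) f x <= \int[mu]_(x in B) f x.
Proof.
move=> mA mB AB fi f0; apply: fine_le.
- apply: integrable_fin_num => //; exact: integrableS fi.
- exact: integrable_fin_num.
- by apply: ge0_subset_integral => //; case/integrableP : fi.
Qed.

Lemma Rintegral_restrict_eq (A B : set R) f : f \_ A = f \_ B ->
  \int[mu]_(x in A) f x = \int[mu]_(x in B) f x.
Proof. by move=> fAB; rewrite Rintegral_mkcond fAB -Rintegral_mkcond. Qed.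

Lemma Rintegral1_oo a b : a <= b -> \int[mu]_(x in `]a, b[) (1 : R) = b - a.
Proof.
move=> ab; rewrite Rintegral_cst// mul1r.
apply: (etrans (congr1 fine (lebesgue_measure_itv `]a, b[))); rewrite /= lte_fin.
by move: ab; rewrite le_eqVlt => /predU1P[->|->]//; rewrite ltxx subrr.
Qed.

(** The end points count as outside, so boundary terms at [a] and [b] are zero. *)
Definition vanishes_off a b f := forall x, x \notin `]a, b[ -> f x = 0.

(** The primitive of [psi] that starts at [a] vanishes beyond [b] because [psi] has mean zero.
    Cauchy-Schwarz against the constant 1 bounds phi^2 pointwise by (b - a) times the integral of
    psi^2; integrating gives the second factor b - a. *)
Lemma ex_antiderivative a b psi : a < b -> smooth psi ->
  vanishes_off a b psi -> \int[mu]_(x in `]a, b[) psi x = 0 ->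
  exists phi, [/\ smooth phi, vanishes_off a b phi,
    forall x : R, is_derive x 1 phi (psi x) &
    \int[mu]_(x in `]a, b[) phi x ^+ 2 <=
      (b - a) ^+ 2 * \int[mu]_(x in `]a, b[) psi x ^+ 2].
Proof.
move=> ab spsi vpsi psi0.
have cpsi := smooth_continuous spsi.
(* Starting at [a - 1] makes every x >= a an interior point for the fundamental theorem of calculus;
   nothing is added, since [psi] is 0 up to [a]. *)
pose phi x := \int[mu]_(t in `[a - 1, x]) psi t.
have psia y : y <= a -> psi y = 0.
  by move=> ya; apply: vpsi; rewrite in_itv/= ltNge ya.
have phia y : y <= a -> phi y = 0.
  move=> ya; rewrite /phi -(Rintegral_set0 mu psi); apply: Rintegral_restrict_eq.
  apply/funext => t; rewrite /patch in_set0; case: ifPn => //.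
  by rewrite inE/= in_itv/= => /andP[_ ty]; rewrite psia// (le_trans ty).
have phix x : phi x = \int[mu]_(t in `]a, x]) psi t.
  apply: Rintegral_restrict_eq; apply/funext => t; rewrite /patch !mem_setE !in_itv/=.
  have [tx|] := leP t x; rewrite ?andbF// !andbT.
  have [/psia ->|at_] := leP t a; first by rewrite if_same.
  by rewrite ifT// (le_trans _ (ltW at_))// gerBl.
have phib x : b <= x -> phi x = 0.
  move=> bx; rewrite -psi0 phix; apply: Rintegral_restrict_eq.
  apply/funext => t; rewrite /patch !mem_setE; case: ifPn.
    rewrite in_itv/= => /andP[at_ tx]; case: ifPn => // h.
    by rewrite vpsi.
  case: ifPn => // + /negP h; rewrite in_itv/= => /andP[at_ tb]; exfalso; apply: h.
  by rewrite in_itv/= at_ (le_trans (ltW tb)).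
have dphi (x : R) : is_derive x 1 phi (psi x).
  have [xa|ax] := ltP x a.
    rewrite psia ?ltW//; apply: (@near_eq_is_derive _ _ _ (cst (0 : R))).
    by near=> y; rewrite phia//; apply: ltW; near: y; exact: lt_nbhsl.
  have [] := @continuous_FTC1_closed R psi (a - 1) x (x + 1) _ _ _ (cpsi x).
  - by rewrite ltrDl.
  - exact: continuous_integrable_cc.
  - by rewrite (lt_le_trans _ ax)// ltrBlDr ltrDl.
  by move=> dx <-; exact: is_derive_derive1.
exists phi; split => //.
- exact: smooth_antiderivative dphi spsi.
- by move=> x; rewrite in_itv/= negb_and -!leNgt => /orP[/phia|/phib].
- have sq : sqint `]a, b[ psi by exact: sqint_continuous.
  have bound x : `]a, b[%classic x -> phi x ^+ 2 <=
      (b - a) * \int[mu]_(t in `]a, b[) psi t ^+ 2.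
    move=> /=; rewrite in_itv/= => /andP[ax xb].
    have sub : `]a, x]%classic `<=` `]a, b[%classic.
      by apply: subset_itvl; rewrite bnd_simp.
    have sq1 : sqint `]a, x] psi by apply: sqintS sq.
    have one : sqint `]a, x] (cst (1 : R)).
      apply: (@sqintS _ _ `]a, b[) => //; apply: sqint_continuous; exact: cst_continuous.
    have := sqint_CS (measurable_itv _) one sq1.
    have -> : \int[mu]_(t in `]a, x]) (cst 1 t * psi t) = phi x.
      by rewrite phix; apply: eq_Rintegral => t _; rewrite mul1r.
    move=> /le_trans; apply.
    apply: ler_pM.
    - by apply: Rintegral_ge0 => t _; rewrite sqr_ge0.
    - by apply: Rintegral_ge0 => t _; rewrite sqr_ge0.
    - have <- : \int[mu]_(x in `]a, b[) (cst 1 x ^+ 2) = b - a.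
        rewrite -(Rintegral1_oo (ltW ab)).
        by apply: eq_Rintegral => t _; rewrite expr1n.
      apply: subset_Rintegral => //; last by move=> t _; rewrite sqr_ge0.
      by have [] : sqint `]a, b[ (cst (1 : R)) by apply: sqint_continuous; exact: cst_continuous.
    - apply: subset_Rintegral => //; last by move=> t _; rewrite sqr_ge0.
      by case: sq.
  have : \int[mu]_(x in `]a, b[) phi x ^+ 2 <=
      \int[mu]_(x in `]a, b[) ((b - a) * \int[mu]_(t in `]a, b[) psi t ^+ 2).
    apply: le_Rintegral => //.
    - have cphi : continuous phi.
        by apply: smooth_continuous; exact: smooth_antiderivative dphi spsi.
      by have [_ ] := sqint_continuous a b cphi.
    - by apply: continuous_integrable_oo => x; exact: cst_continuous.
  move=> /le_trans; apply.
  set c := \int[mu]_(t in _) psi _ ^+ _.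
  rewrite -[X in Rintegral _ _ X](_ : (fun _ => (b - a) * c * 1) = _); last first.
    by apply/funext => t; rewrite mulr1.
  rewrite RintegralZl//; last by apply: continuous_integrable_oo => x; exact: cst_continuous.
  by rewrite (Rintegral1_oo (ltW ab)) mulrAC expr2.
Unshelve. all: by end_near. Qed.

Lemma poly_antiderivative s :
  exists2 S : {poly R}, (size S <= (size s).+1)%N & S^`() = s.
Proof.
exists (\poly_(i < (size s).+1) (s`_i.-1 / i%:R)); first exact: size_poly.
apply/polyP => i; rewrite coef_deriv coef_poly/= ltnS.
case: ltnP => si; last by rewrite mul0rn nth_default.
by rewrite -[LHS]mulr_natr divfK// pnatr_eq0.
Qed.

Lemma continuous_derivable_oo f a b : (forall x, derivable f x 1) ->
  derivable_oo_LRcontinuous f a b.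
Proof.
move=> df; have cf : continuous f.
  by move=> x; apply/differentiable_continuous/derivable1_diffP.
by split=> //; [exact: cvg_at_right_filter (cf a)|exact: cvg_at_left_filter (cf b)].
Qed.

Lemma Rintegral_parts_poly a b psi phi S : a < b ->
  continuous psi -> vanishes_off a b phi ->
  (forall x : R, is_derive x 1 phi (psi x)) ->
  \int[mu]_(x in `]a, b[) (phi x * (S^`()).[x]) =
  - \int[mu]_(x in `]a, b[) (psi x * S.[x]).
Proof.
move=> ab cpsi vphi dphi.
have dphi' x : derivable phi x 1 by case: (dphi x).
have cphi : continuous phi.
  by move=> x; apply/differentiable_continuous/derivable1_diffP.
rewrite !Rintegral_oo_cc; first last.
- by move=> x; apply: continuousM; [exact: cphi|exact: continuous_horner].
- by move=> x; apply: continuousM; [exact: cpsi|exact: continuous_horner].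
rewrite (@Rintegration_by_parts R phi (horner S) psi)//.
- by rewrite !vphi ?in_itv/= ?ltxx ?andbF// !mul0r subrr sub0r.
- exact: continuous_subspaceT.
- exact: continuous_derivable_oo.
- by move=> x _; rewrite derive1E; exact: derive_val.
- by apply: continuous_subspaceT; exact: continuous_horner.
- by apply: continuous_derivable_oo => x; exact: derivable_horner.
- by move=> x _; rewrite derivE.
Qed.

(** Orthogonality to 1 gives the mean zero needed for one primitive. That primitive is orthogonal to
    polynomials of one degree less, by parts against an antiderivative of the test polynomial. Each
    step costs a factor b - a in norm. *)
Lemma ex_iterated_antiderivative a b n psi : a < b -> smooth psi ->
  vanishes_off a b psi ->
  (forall s, (size s <= n)%N -> \int[mu]_(x in `]a, b[) (psi x * s.[x]) = 0) ->
  exists phi, [/\ smooth phi, vanishes_off a b phi, derive1n n phi = psi &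
    \int[mu]_(x in `]a, b[) phi x ^+ 2 <=
      ((b - a) ^+ n) ^+ 2 * \int[mu]_(x in `]a, b[) psi x ^+ 2].
Proof.
move=> ab; elim: n psi => [|n IH] psi spsi vpsi opsi.
  by exists psi; split => //; rewrite expr0 expr1n mul1r.
have [|phi1 [sphi1 vphi1 dphi1 bphi1]] := ex_antiderivative ab spsi vpsi.
  rewrite -[RHS](opsi 1); last by rewrite size_poly1.
  by apply: eq_Rintegral => x _; rewrite hornerC mulr1.
have [//|//|s sn|phi [sphi vphi dphi bphi]] := IH phi1.
  have [S sS <-] := poly_antiderivative s.
  rewrite (Rintegral_parts_poly _ ab (smooth_continuous spsi) vphi1 dphi1).
  by rewrite opsi ?oppr0// (leq_trans sS).
exists phi; split => //.
  rewrite derive1nS dphi; apply/funext => x; rewrite derive1E; exact: derive_val.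
apply: (le_trans bphi).
have -> : ((b - a) ^+ n.+1) ^+ 2 = ((b - a) ^+ n) ^+ 2 * (b - a) ^+ 2.
  by rewrite -exprMn -exprSr.
by rewrite -mulrA ler_wpM2l// sqr_ge0.
Qed.

End antiderivative.

(** * Integrals of polynomials *)

Section poly_integrals.
Context {R : realType}.
Notation mu := (@lebesgue_measure R).
Implicit Types (a b c : R) (s S : {poly R}) (r : R -> R).

Lemma Rintegral_cst_oo a b k : a <= b -> \int[mu]_(x in `]a, b[) k = k * (b - a).
Proof.
move=> ab; rewrite -(Rintegral1_oo ab) -RintegralZl//.
  by apply: eq_Rintegral => x _; rewrite mulr1.
by apply: continuous_integrable_oo => x; exact: cst_continuous.
Qed.

Lemma Rintegral_deriv_poly a b S : a <= b ->
  \int[mu]_(x in `]a, b[) (S^`()).[x] = S.[b] - S.[a].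
Proof.
rewrite le_eqVlt => /predU1P[->|ab].
  by rewrite set_itvoo0 Rintegral_set0 subrr.
rewrite Rintegral_oo_cc; last exact: continuous_horner.
rewrite /Rintegral (@continuous_FTC2 _ _ (horner S))//.
- by apply: continuous_subspaceT; exact: continuous_horner.
- by apply: continuous_derivable_oo => x; exact: derivable_horner.
- by move=> x _; rewrite derivE.
Qed.

Lemma continuous_sqr_horner s : continuous (fun x : R => s.[x] ^+ 2).
Proof.
have -> : (fun x : R => s.[x] ^+ 2) = horner (s ^+ 2).
  by apply/funext => x; rewrite horner_exp.
exact: continuous_horner.
Qed.

(** An antiderivative [S] of s^2 is nondecreasing; if the integral were zero, [S] would be constant
    on [a, b], hence constant as a polynomial, and s^2 = S' would vanish. *)
Lemma Rintegral_poly_sqr_gt0 a b s : a < b -> s != 0 ->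
  0 < \int[mu]_(x in `]a, b[) s.[x] ^+ 2.
Proof.
move=> ab s0; have [S _ dS] := poly_antiderivative (s ^+ 2).
have SE c d : c <= d -> S.[d] - S.[c] = \int[mu]_(x in `]c, d[) s.[x] ^+ 2.
  move=> cd; rewrite -Rintegral_deriv_poly// dS.
  by apply: eq_Rintegral => x _; rewrite horner_exp.
have Smono c d : c <= d -> S.[c] <= S.[d].
  by move=> cd; rewrite -subr_ge0 SE// Rintegral_ge0// => x _; exact: sqr_ge0.
rewrite lt_neqAle Rintegral_ge0 ?andbT; last by move=> x _; exact: sqr_ge0.
apply/negP => /eqP/esym; rewrite -SE ?ltW// => /eqP; rewrite subr_eq0 => /eqP Sab.
have Scst x : a <= x <= b -> root (S - S.[a]%:P) x.
  move=> /andP[ax xb]; rewrite /root !hornerE subr_eq0 eq_le.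
  by apply/andP; split; [rewrite -Sab|]; exact: Smono.
(* Distinct points of ]a, b], as many as the size of [S - S.[a]%:P], which is too many roots for a
   nonzero polynomial. *)
pose rs := [seq a + (b - a) / i.+1%:R | i <- iota 0 (size (S - S.[a]%:P))].
have /eqP : S - S.[a]%:P = 0.
  apply: (@roots_geq_poly_eq0 _ _ rs).
  - apply/allP => _ /mapP[i _ ->]; apply: Scst.
    have i1 : 0 < (i.+1%:R : R)^-1 <= 1.
      by rewrite invr_gt0 ltr0n/= invf_le1 ?ltr0n// ler1n.
    by move: i1; set t := _^-1 => /andP[t0 t1]; apply/andP; split; nra.
  - rewrite map_inj_uniq ?iota_uniq// => i j /addrI/mulfI h.
    have /h/invr_inj/eqP : b - a != 0 by rewrite subr_eq0 gt_eqF.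
    by rewrite eqr_nat => /eqP[].
  - by rewrite size_map size_iota.
rewrite subr_eq0 => /eqP SC; move: dS; rewrite SC derivC => /esym/eqP.
by rewrite expf_eq0 (negbTE s0).
Qed.

Lemma linear_Rintegral_poly a b r : continuous r ->
  linear_for *%R (fun s => \int[mu]_(x in `]a, b[) (r x * s.[x])).
Proof.
move=> cr k s t.
have ci u : mu.-integrable `]a, b[ (EFin \o (fun x => r x * u.[x])).
  apply: continuous_integrable_oo => x.
  by apply: continuousM; [exact: cr|exact: continuous_horner].
rewrite -RintegralZl// -RintegralD//; last exact: integrableEZ.
by apply: eq_Rintegral => x _; rewrite hornerD hornerZ; ring.
Qed.

(** [poly_riesz] represents the coefficient functional as the L^2 product with some [v], and
    Cauchy-Schwarz gives the bound with the norm of [v] as [K]. *)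
Lemma poly_coef_bound a b n i : a < b -> exists2 K, 0 <= K &
  forall s, (size s <= n)%N -> `|s`_i| <= K * Num.sqrt (\int[mu]_(x in `]a, b[) s.[x] ^+ 2).
Proof.
move=> ab.
have c1 : continuous (fun _ : R => 1 : R) by move=> x; exact: cst_continuous.
have [| |v vn rv] := @poly_riesz R n _ (fun s => s`_i) (linear_Rintegral_poly a b c1).
- by move=> k s t; rewrite coefD coefZ.
- move=> s _ s0; have := Rintegral_poly_sqr_gt0 ab s0; congr (0 < _).
  by apply: eq_Rintegral => x _; rewrite mul1r hornerM expr2.
exists (Num.sqrt (\int[mu]_(x in `]a, b[) v.[x] ^+ 2)); first exact: sqrtr_ge0.
move=> s sn; rewrite -sqrtrM; last by apply: Rintegral_ge0 => x _; exact: sqr_ge0.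
rewrite -rv// -sqrtr_sqr ler_wsqrtr//.
have := sqint_CS (measurable_itv _) (sqint_continuous a b (@continuous_horner _ v))
  (sqint_continuous a b (@continuous_horner _ s)).
congr (_ ^+ 2 <= _); by apply: eq_Rintegral => x _; rewrite mul1r hornerM.
Qed.

(** Equivalence of the sup and L^2 norms in bounded degree, obtained by summing the coefficient
    bounds with |x| <= |a| + |b|. *)
Lemma poly_sup_bound a b n : a < b -> exists2 K, 0 < K &
  forall s, (size s <= n)%N -> forall x, x \in `[a, b] ->
    s.[x] ^+ 2 <= K * \int[mu]_(x in `]a, b[) s.[x] ^+ 2.
Proof.
move=> ab.
have /choice[A hA] : forall i : nat, exists A, 0 <= A /\ forall s, (size s <= n)%N ->
    `|s`_i| <= A * Num.sqrt (\int[mu]_(x in `]a, b[) s.[x] ^+ 2).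
  by move=> i; have [K K0 hK] := poly_coef_bound n i ab; exists K.
pose M := `|a| + `|b|.
have M0 : 0 <= M by rewrite addr_ge0.
pose B := \sum_(i < n) A i * M ^+ i.
have B0 : 0 <= B by apply: sumr_ge0 => i _; rewrite mulr_ge0 ?exprn_ge0//; case: (hA i).
exists (B ^+ 2 + 1); first by rewrite ltr_wpDl// sqr_ge0.
move=> s sn x; rewrite in_itv/= => /andP[ax xb].
have xM : `|x| <= M.
  rewrite /M ler_norml; have := ler_norm b; have := ler_norm (- a); rewrite normrN.
  by have := normr_ge0 a; have := normr_ge0 b => *; apply/andP; split; lra.
set I := \int[mu]_(x in _) _.
have I0 : 0 <= I by apply: Rintegral_ge0 => y _; exact: sqr_ge0.
apply: (@le_trans _ _ (B ^+ 2 * I)); last by rewrite ler_wpM2r// lerDl.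
have : `|s.[x]| <= B * Num.sqrt I.
  rewrite (horner_coef_wide x sn) mulr_suml (le_trans (ler_norm_sum _ _ _))//.
  apply: ler_sum => i _; rewrite normrM normrX mulrAC.
  have [_ h] := hA i; apply: ler_pM => //; first exact: h.
  by rewrite lerXn2r// nnegrE.
rewrite -[B ^+ 2 * I](_ : (B * Num.sqrt I) ^+ 2 = _); last by rewrite exprMn sqr_sqrtr.
move=> h; have := ler_pM (normr_ge0 _) (normr_ge0 _) h h.
by rewrite -!expr2 real_normK ?num_real.
Qed.

Lemma ex_cutoff a b n d : a < b -> 0 < d <= 1 -> exists r, [/\
  smooth r, forall x, 0 <= r x <= 1,
  exists a' b', [/\ a < a', a' < b', b' < b & vanishes_off a' b' r] &
  forall s, (size s <= n)%N -> (1 - d) * \int[mu]_(x in `]a, b[) s.[x] ^+ 2 <=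
    \int[mu]_(x in `]a, b[) (r x * s.[x] ^+ 2)].
Proof.
move=> ab /andP[d0 d1]; have [K K0 hK] := poly_sup_bound n ab.
have ba : 0 < b - a by rewrite subr_gt0.
(* The first bound leaves room for a strip of width 2e at each end; the second makes their joint
   mass, at most 4 e K I, no more than d/2 I. *)
pose e := Num.min ((b - a) / 8) (d / (8 * K)).
have e0 : 0 < e by rewrite lt_min !divr_gt0// mulr_gt0.
have eba : e * 8 <= b - a by rewrite -ler_pdivlMr// ge_min lexx.
have eK : e * (8 * K) <= d by rewrite -ler_pdivlMr ?mulr_gt0// ge_min lexx orbT.
(* Chosen so that the loss 2/(l e) in [cutoff_ge] equals d/2. *)
pose l := 4 / (d * e).
have l0 : 0 < l by rewrite divr_gt0// mulr_gt0.
have le : 2 / (l * e) = d / 2.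
  by rewrite /l; field; rewrite ?gt_eqF.
pose r := cutoff l (a + e) (b - e).
have sr : smooth r by exact: smooth_cutoff.
exists r; split => //.
- by move=> x; rewrite cutoff_ge0 cutoff_le1.
- exists (a + e), (b - e); split; [lra|lra|lra|].
  by move=> x; exact: cutoff_eq0.
move=> s sn; set I := \int[mu]_(x in _) _.
have I0 : 0 <= I by apply: Rintegral_ge0 => y _; exact: sqr_ge0.
have cs := @continuous_sqr_horner s.
have its c c' := continuous_integrable_oo c c' cs.
have irs c c' : mu.-integrable `]c, c'[ (EFin \o (fun x => r x * s.[x] ^+ 2)).
  apply: continuous_integrable_oo => x.
  by apply: continuousM; [exact: smooth_continuous|exact: cs].
have edge c c' : a <= c -> c <= c' -> c' <= b ->
    \int[mu]_(x in `]c, c'[) s.[x] ^+ 2 <= K * I * (c' - c).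
  move=> ac cc' cb; rewrite -Rintegral_cst_oo//.
  apply: le_Rintegral => //.
    by apply: continuous_integrable_oo => x; exact: cst_continuous.
  move=> x /=; rewrite in_itv/= => /andP[cx xc']; apply: hK => //.
  by rewrite in_itv/= (le_trans ac (ltW cx)) (le_trans (ltW xc')).
pose c := a + e + e; pose c' := b - e - e.
have hsplit : I = \int[mu]_(x in `]a, c[) s.[x] ^+ 2 +
    (\int[mu]_(x in `]c, c'[) s.[x] ^+ 2 + \int[mu]_(x in `]c', b[) s.[x] ^+ 2).
  rewrite /I (@Rintegral_oo_split _ _ a c b)//; [|rewrite /c; lra|rewrite /c; lra].
  by rewrite (@Rintegral_oo_split _ _ c c' b)//; rewrite /c /c'; lra.
have e1 : \int[mu]_(x in `]a, c[) s.[x] ^+ 2 <= K * I * (c - a).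
  by apply: edge; rewrite /c; lra.
have e2 : \int[mu]_(x in `]c', b[) s.[x] ^+ 2 <= K * I * (b - c').
  by apply: edge; rewrite /c'; lra.
have inner : (1 - d / 2) * \int[mu]_(x in `]c, c'[) s.[x] ^+ 2 <=
    \int[mu]_(x in `]a, b[) (r x * s.[x] ^+ 2).
  apply: (@le_trans _ _ (\int[mu]_(x in `]c, c'[) (r x * s.[x] ^+ 2))).
    rewrite -RintegralZl//; apply: le_Rintegral => //; first exact: integrableEZ.
    move=> x /=; rewrite in_itv/= => /andP[cx xc'].
    rewrite ler_wpM2r ?sqr_ge0// -le; apply: cutoff_ge => //.
    by rewrite -/c -/c' !ltW.
  apply: subset_Rintegral => //.
    by apply: subset_itv; rewrite bnd_simp /c /c'; lra.
  by move=> x _; rewrite mulr_ge0 ?sqr_ge0 ?cutoff_ge0.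
apply: le_trans inner.
move: hsplit e1 e2; set X := \int[mu]_(x in `]c, c'[) _.
set Y := \int[mu]_(x in `]a, c[) _; set Z := \int[mu]_(x in `]c', b[) _.
rewrite /c /c' => hs e1 e2.
have YZ : Y + Z <= d / 2 * I.
  apply: (@le_trans _ _ ((e * (8 * K)) / 2 * I)); last by rewrite ler_wpM2r// ler_wpM2r.
  lra.
have : X >= (1 - d / 2) * I by lra.
(* This uses (1 - d/2)^2 >= 1 - d. *)
by move=> hX; nra.
Qed.

End poly_integrals.

(** * The lower bound on one cell *)

Section cell.
Context {R : realType}.
Notation mu := (@lebesgue_measure R).
Implicit Types (a b c : R) (s : {poly R}) (f g u w : R -> R).

Lemma Rintegral_vanishes_off a b c d f : a <= c -> d <= b ->
  vanishes_off c d f ->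
  \int[mu]_(x in `]a, b[) f x = \int[mu]_(x in `]c, d[) f x.
Proof.
move=> ac db vf; apply: Rintegral_restrict_eq; apply/funext => x.
rewrite /patch !mem_setE; case: (boolP (x \in `]c, d[)) => [|/vf ->]; last first.
  by rewrite if_same.
rewrite !in_itv/= => /andP[cx xd].
by rewrite (le_lt_trans ac cx) (lt_le_trans xd db).
Qed.

Lemma vanishes_offW a b c d f : a <= c -> d <= b ->
  vanishes_off c d f -> vanishes_off a b f.
Proof.
move=> ac db vf x xab; apply: vf; apply: contra xab.
rewrite !in_itv/= => /andP[cx xd].
by rewrite (le_lt_trans ac cx) (lt_le_trans xd db).
Qed.

Lemma sqint_normCS (A : set R) f g : measurable A -> sqint A f -> sqint A g ->
  `|\int[mu]_(x in A) (f x * g x)| <=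
  Num.sqrt (\int[mu]_(x in A) f x ^+ 2) * Num.sqrt (\int[mu]_(x in A) g x ^+ 2).
Proof.
move=> mA sf sg; rewrite -sqrtrM; last by apply: Rintegral_ge0 => x _; exact: sqr_ge0.
by rewrite -sqrtr_sqr ler_wsqrtr// sqint_CS.
Qed.

Lemma ler_mul_1subr (x y : R) : 0 <= y ->
  (forall d, 0 < d < 1 -> (1 - d) * x <= y) -> x <= y.
Proof.
move=> y0 h; rewrite leNgt; apply/negP => yx.
have x0 : 0 < x by exact: le_lt_trans yx.
(* For this [d], (1 - d) x is the midpoint of [x] and [y], which exceeds [y]. *)
have := h ((x - y) / (2 * x)).
have -> : (1 - (x - y) / (2 * x)) * x = (x + y) / 2 by field; rewrite gt_eqF.
have -> : 0 < (x - y) / (2 * x) < 1.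
  rewrite divr_gt0 ?subr_gt0 ?mulr_gt0//= ltr_pdivrMr ?mulr_gt0//; lra.
by move=> /(_ isT); lra.
Qed.

(** The duality argument on one cell. [B] stands for any lower bound of the L^2 distance from the
    two-piece polynomial to the polynomials of size at most [n], and [g] for the weak derivative of
    order [n]. *)
Lemma cell_lower_bound (l m r : R) (n : nat) (qm qp : {poly R}) u w g B :
  l < m -> m < r -> (size qm <= n)%N -> (size qp <= n)%N ->
  {in `]l, m[, forall x, w x = qm.[x]} -> {in `]m, r[, forall x, w x = qp.[x]} ->
  sqint `]l, r[ u -> sqint `]l, r[ w -> sqint `]l, r[ g ->
  (forall a b phi, l < a -> a < b -> b < r -> smooth phi -> vanishes_off a b phi ->
    \int[mu]_(x in `]l, r[) (u x * derive1n n phi x) =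
    (-1) ^+ n * \int[mu]_(x in `]l, r[) (g x * phi x)) ->
  0 <= B ->
  (forall v : {poly R}, (size v <= n)%N -> B ^+ 2 <=
    \int[mu]_(x in `]l, m[) (qm - v).[x] ^+ 2 +
    \int[mu]_(x in `]m, r[) (qp - v).[x] ^+ 2) ->
  B <= Num.sqrt (\int[mu]_(x in `]l, r[) (u x - w x) ^+ 2) +
       (r - l) ^+ n * Num.sqrt (\int[mu]_(x in `]l, r[) g x ^+ 2).
Proof.
move=> lm mr sqm sqp wqm wqp su sw sg weak B0 hB.
have lr : l < r by exact: lt_trans mr.
set A := Num.sqrt _; set G := Num.sqrt _; set H := _ ^+ n.
have A0 : 0 <= A by exact: sqrtr_ge0.
have G0 : 0 <= G by exact: sqrtr_ge0.
have H0 : 0 <= H by rewrite exprn_ge0// subr_ge0 ltW.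
have AHG0 : 0 <= A + H * G by rewrite addr_ge0// mulr_ge0.
suff : B ^+ 2 <= (A + H * G) ^+ 2 by rewrite ler_sqr ?nnegrE.
(* The limit of increasing cutoffs is replaced by an arbitrary loss [d], fixed from here on. *)
apply: ler_mul_1subr => [|d /andP[d0 d1]]; first exact: sqr_ge0.
have d01 : 0 < d <= 1 by rewrite d0 ltW.
(* One cutoff per half cell. Both vanish near [m], so the jump of [w] does not spoil the smoothness
   of [psi]. *)
have [r1 [sr1 r1b [a1 [b1 [la1 a1b1 b1m v1]]] hr1]] := ex_cutoff n lm d01.
have [r2 [sr2 r2b [a2 [b2 [ma2 a2b2 b2r v2]]] hr2]] := ex_cutoff n mr d01.
have cr1 := smooth_continuous sr1; have cr2 := smooth_continuous sr2.
have v1' : vanishes_off l m r1 by apply: vanishes_offW v1; exact: ltW.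
have v2' : vanishes_off m r r2 by apply: vanishes_offW v2; exact: ltW.
have ch s : continuous (horner s) by exact: continuous_horner.
have split12 (f1 f2 : R -> R) : continuous f1 -> continuous f2 ->
    \int[mu]_(x in `]l, r[) (r1 x * f1 x + r2 x * f2 x) =
    \int[mu]_(x in `]l, m[) (r1 x * f1 x) + \int[mu]_(x in `]m, r[) (r2 x * f2 x).
  move=> c1 c2; rewrite RintegralD//; first last.
  - by apply: continuous_integrable_oo => x; apply: continuousM; [exact: cr2|exact: c2].
  - by apply: continuous_integrable_oo => x; apply: continuousM; [exact: cr1|exact: c1].
  congr (_ + _); apply: Rintegral_vanishes_off => //; try exact: ltW.
    by move=> x /v1' ->; rewrite mul0r.
  by move=> x /v2' ->; rewrite mul0r.
have off1 x : m <= x -> r1 x = 0.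
  by move=> mx; apply: v1'; rewrite in_itv/= negb_and -!leNgt mx orbT.
have off2 x : x <= m -> r2 x = 0.
  by move=> mx; apply: v2'; rewrite in_itv/= negb_and -!leNgt mx.
have cD (f1 f2 : R -> R) : continuous f1 -> continuous f2 ->
    continuous (fun x => f1 x + f2 x).
  by move=> c1 c2 x; apply: continuousD; [exact: c1|exact: c2].
have cM (f1 f2 : R -> R) : continuous f1 -> continuous f2 ->
    continuous (fun x => f1 x * f2 x).
  by move=> c1 c2 x; apply: continuousM; [exact: c1|exact: c2].
pose rho x := r1 x + r2 x.
pose sigma x := r1 x * qm.[x] + r2 x * qp.[x].
have crho : continuous rho by exact: cD.
have csigma : continuous sigma by apply: cD; exact: cM.
(* [v] is the [rho]-weighted projection of [w], as [sigma] equals [rho] times [w] on the cell. The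
   weighted product is positive definite since the cutoffs retain the fraction 1 - d > 0 of each
   mass. *)
have [s sn s0|v vn hv] := @poly_riesz R n _ _ (linear_Rintegral_poly (r := rho) l r crho)
    (linear_Rintegral_poly (r := sigma) l r csigma).
  have -> : \int[mu]_(x in `]l, r[) (rho x * (s * s).[x]) =
      \int[mu]_(x in `]l, r[) (r1 x * s.[x] ^+ 2 + r2 x * s.[x] ^+ 2).
    by apply: eq_Rintegral => x _; rewrite hornerM /rho; ring.
  rewrite split12//; try exact: continuous_sqr_horner.
  have := hr1 s sn; have := hr2 s sn.
  have := Rintegral_poly_sqr_gt0 lm s0; have := Rintegral_poly_sqr_gt0 mr s0.
  set X := Rintegral _ _ _; set Y := Rintegral _ _ _ => X0 Y0.
  have : 0 < (1 - d) * X by rewrite mulr_gt0// subr_gt0.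
  have : 0 < (1 - d) * Y by rewrite mulr_gt0// subr_gt0.
  by lra.
pose psi x := r1 x * (qm - v).[x] + r2 x * (qp - v).[x].
have spsi : smooth psi.
  by apply: smoothD; apply: smoothM => //; exact: smooth_horner.
have cpsi := smooth_continuous spsi.
have sqpsi : sqint `]l, r[ psi by exact: sqint_continuous.
have vpsi : vanishes_off a1 b2 psi.
  have a12 : a1 <= a2 by rewrite ltW// (lt_trans a1b1)// (lt_trans b1m).
  have b12 : b1 <= b2 by rewrite ltW// (lt_trans b1m)// (lt_trans ma2).
  move=> x xo; rewrite /psi (vanishes_offW (lexx _) b12 v1)//.
  by rewrite (vanishes_offW a12 (lexx _) v2)// !mul0r addr0.
have orth s : (size s <= n)%N -> \int[mu]_(x in `]l, r[) (psi x * s.[x]) = 0.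
  move=> sn; have /eqP := hv s sn; rewrite eq_sym -subr_eq0 => /eqP <-.
  rewrite -RintegralB//; first last.
  - by apply: continuous_integrable_oo; exact: cM.
  - by apply: continuous_integrable_oo; exact: cM.
  apply: eq_Rintegral => x _.
  by rewrite /psi /rho /sigma hornerM !hornerD !hornerN; ring.
have a1b2 : a1 < b2 by rewrite (lt_trans a1b1)// (lt_trans b1m)// (lt_trans ma2).
have restr f : vanishes_off a1 b2 f ->
    \int[mu]_(x in `]a1, b2[) f x = \int[mu]_(x in `]l, r[) f x.
  by move=> vf; rewrite -(@Rintegral_vanishes_off l r a1 b2)// ltW.
have [s sn|phi [sphi vphi dphi bphi]] := ex_iterated_antiderivative (n := n) a1b2 spsi vpsi.
  by rewrite restr ?orth// => x /vpsi ->; rewrite mul0r.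
have cphi := smooth_continuous sphi.
have sqphi : sqint `]l, r[ phi by exact: sqint_continuous.
pose q := \int[mu]_(x in `]l, m[) (r1 x * (qm - v).[x] ^+ 2) +
          \int[mu]_(x in `]m, r[) (r2 x * (qp - v).[x] ^+ 2).
have csq s : continuous (fun x : R => s.[x] ^+ 2) by exact: continuous_sqr_horner.
have Bq : (1 - d) * B ^+ 2 <= q.
  apply: (@le_trans _ _ ((1 - d) * (\int[mu]_(x in `]l, m[) (qm - v).[x] ^+ 2 +
    \int[mu]_(x in `]m, r[) (qp - v).[x] ^+ 2))).
    by apply: ler_wpM2l; [rewrite subr_ge0 ltW|exact: hB].
  have size_qv (t : {poly R}) : (size t <= n)%N -> (size (t - v)%R <= n)%N.
    by move=> tn; rewrite (leq_trans (size_polyD _ _))// size_polyN geq_max tn vn.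
  by rewrite mulrDr lerD// ?hr1 ?hr2// size_qv.
have q0 : 0 <= q by apply: le_trans Bq; rewrite mulr_ge0 ?sqr_ge0// subr_ge0 ltW.
(* At each point at most one cutoff is nonzero, and its square is at most itself as its values lie
   in [0, 1]. *)
have psiq : \int[mu]_(x in `]l, r[) psi x ^+ 2 <= q.
  rewrite /q -split12//; apply: le_Rintegral => //; first by case: sqpsi.
    by apply: continuous_integrable_oo; apply: cD; exact: cM.
  move=> x _; rewrite /psi; have [xm|mx] := leP x m.
    rewrite (off2 _ xm) !mul0r !addr0 exprMn ler_wpM2r ?sqr_ge0//.
    by have /andP[? ?] := r1b x; rewrite expr2 ler_piMl.
  rewrite (off1 _ (ltW mx)) !mul0r !add0r exprMn ler_wpM2r ?sqr_ge0//.
  by have /andP[? ?] := r2b x; rewrite expr2 ler_piMl.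
(* Orthogonality allows [w] to be replaced by [w - v]. At [m] both cutoffs vanish, whatever the
   value of [w] there. *)
have wpsi : \int[mu]_(x in `]l, r[) (w x * psi x) = q.
  have sqv : sqint `]l, r[ (horner v) by exact: sqint_continuous.
  rewrite /q -split12// -[LHS]subr0 -[X in _ - X](orth _ vn) -RintegralB//; first last.
  - by apply: sqintM.
  - by apply: sqintM.
  apply: eq_Rintegral => x; rewrite inE/= in_itv/= => /andP[lx xr].
  rewrite /psi; have [xm|mx|->] := ltgtP x m.
  - rewrite (off2 _ (ltW xm)) wqm ?in_itv/= ?lx// !hornerD !hornerN; ring.
  - rewrite (off1 _ (ltW mx)) wqp ?in_itv/= ?mx// !hornerD !hornerN; ring.
  - by rewrite off1// off2//; ring.
have wupsi : `|\int[mu]_(x in `]l, r[) ((u x - w x) * psi x)| <= A * Num.sqrt q.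
  apply: le_trans (sqint_normCS _ (sqintB _ su sw) sqpsi) _ => //.
  by rewrite ler_wpM2l// ler_wsqrtr.
(* Since [psi] is the derivative of order [n] of [phi], the weak derivative moves onto [u]; the norm
   of [phi] is at most [H] times that of [psi]. *)
have upsi : `|\int[mu]_(x in `]l, r[) (u x * psi x)| <= H * G * Num.sqrt q.
  rewrite -dphi (weak _ _ _ la1 a1b2 b2r sphi vphi) normrM normrX normrN1 expr1n mul1r.
  apply: le_trans (sqint_normCS _ sg sqphi) _ => //.
  rewrite -/G [H * G]mulrC -mulrA ler_wpM2l//.
  rewrite -[H]ger0_norm// -sqrtr_sqr -sqrtrM ?sqr_ge0// ler_wsqrtr//.
  rewrite -restr; last by move=> x /vphi ->; rewrite expr0n.
  apply: (le_trans bphi).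
  rewrite restr; last by move=> x /vpsi ->; rewrite expr0n.
  apply: ler_pM => //; first exact: sqr_ge0.
    by apply: Rintegral_ge0 => x _; exact: sqr_ge0.
  have h0 : 0 <= b2 - a1 by rewrite subr_ge0 ltW.
  have h1 : b2 - a1 <= r - l by rewrite lerB// ltW.
  have h2 : (b2 - a1) ^+ n <= H by rewrite lerXn2r// nnegrE// (le_trans h0).
  by rewrite lerXn2r// nnegrE exprn_ge0.
have qE : q = - (\int[mu]_(x in `]l, r[) ((u x - w x) * psi x)) +
    \int[mu]_(x in `]l, r[) (u x * psi x).
  rewrite addrC -wpsi -RintegralB//; first last.
  - by apply: sqintM => //; exact: sqintB.
  - by apply: sqintM.
  by apply: eq_Rintegral => x _; ring.
have : q <= (A + H * G) * Num.sqrt q.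
  rewrite {1}qE mulrDl lerD//; last exact: le_trans (ler_norm _) upsi.
  by apply: le_trans wupsi; rewrite -normrN ler_norm.
move=> hq; apply: (le_trans Bq).
have sq : q = Num.sqrt q ^+ 2 by rewrite sqr_sqrtr.
rewrite {1}sq ler_sqr ?nnegrE ?sqrtr_ge0//.
have [->//|sq0] := eqVneq (Num.sqrt q) 0.
have sqp0 : 0 < Num.sqrt q by rewrite lt_neqAle eq_sym sq0 sqrtr_ge0.
by rewrite -(ler_pM2r sqp0) -expr2 -sq.
Qed.

End cell.

(** * Norms, jumps and the scaling of Q *)

Section bridge.
Context {R : realType}.
Notation mu := (@lebesgue_measure R).
Implicit Types (a b c h m : R) (s q : {poly R}) (f g u w : R -> R).

Lemma Lnorm2_restrictE a b f :
  ('N[mu]_2%:E [EFin \o (f \_ `]a, b[)] =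
   (\int[mu]_(x in `]a, b[) (f x ^+ 2)%:E) `^ 2^-1)%E.
Proof.
rewrite unlock [in RHS]integral_mkcond; congr (_ `^ _)%E.
apply: eq_integral => x _ /=; rewrite /patch; case: ifPn => _.
  by rewrite powR_mulrn// real_normK// num_real.
by transitivity ((`|0 : R| `^ 2)%:E) => //; rewrite normr0 powR0.
Qed.

Lemma L2normE a b f : L2norm a b f = Num.sqrt (\int[mu]_(x in `]a, b[) f x ^+ 2).
Proof.
rewrite /L2norm Lnorm2_restrictE /Rintegral.
have : (0 <= \int[mu]_(x in `]a, b[) (f x ^+ 2)%:E)%E.
  by apply: integral_ge0 => x _; rewrite lee_fin sqr_ge0.
case: (integral _ _ _) => [t| |]//=; first by rewrite lee_fin => t0; rewrite powR12_sqrt.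
(* For an infinite integral both sides are 0, the default value of [fine], so the formula holds for
   every [f]. *)
by move=> _; rewrite invr_eq0 pnatr_eq0/= sqrtr0.
Qed.

Lemma L2_sqint a b f : L2 a b f -> sqint `]a, b[ f.
Proof.
move=> /andP[/= mf nf].
have {}mf : measurable_fun `]a, b[ f.
  by apply/measurable_restrictT => //; move: mf; rewrite inE.
split=> //; apply/integrableP; split.
  by apply/measurable_EFinP; exact: measurable_funX.
move: nf; rewrite inE/= /finite_norm Lnorm2_restrictE.
have -> : (\int[mu]_(x in `]a, b[) `|(EFin \o (fun x => f x ^+ 2)%R) x| =
    \int[mu]_(x in `]a, b[) (f x ^+ 2)%:E)%E.
  by apply: eq_integral => x _ /=; rewrite ger0_norm ?sqr_ge0.
suff aux (J : \bar R) : (J `^ 2^-1 < +oo -> J < +oo)%E by exact: aux.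
case: J => [t _|/=|//]; first exact: ltry.
by rewrite invr_eq0 pnatr_eq0.
Qed.

Lemma sqintU (A B : set R) f : measurable A -> measurable B ->
  sqint A f -> sqint B f -> sqint (A `|` B) f.
Proof.
move=> mA mB [mf If] [mg Ig]; split; first by apply/measurable_funU.
have mAB : measurable_fun (A `|` B) (EFin \o (fun x => f x ^+ 2)).
  by apply/measurable_funU => //; split; [case/integrableP: If|case/integrableP: Ig].
apply/integrableP; split => //.
have mD : measurable ((A `|` B) `\` A) by apply: measurableD => //; exact: measurableU.
have AB := setDUK (@subsetUl _ A B).
rewrite -AB ge0_integral_setU//; last 2 first.
- by rewrite AB; exact: measurableT_comp.
- by apply/disj_setPS => x [Ax []].
apply: lte_add_pinfty; first by case/integrableP: If.
case/integrableP: Ig => mg2; apply: le_lt_trans; apply: ge0_subset_integral => //.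
  exact: measurableT_comp.
by move=> x [[|//]].
Qed.

Lemma derive1n_eq_poly c d w q : {in `]c, d[, forall x, w x = q.[x]} ->
  forall k x, x \in `]c, d[ -> derive1n k w x = (q^`(k)).[x].
Proof.
move=> wq; elim=> [|k IH] x xcd; first exact: wq.
rewrite derive1nS derive1E derivnS derivE derive1E.
apply: near_eq_derive; near=> y; apply: IH; near: y.
by apply: near_in_itvoo.
Unshelve. all: by end_near. Qed.

Lemma right_deriv_eq_poly c d w q k : c < d ->
  {in `]c, d[, forall x, w x = q.[x]} -> right_deriv w k c = (q^`(k)).[c].
Proof.
move=> cd wq; apply: cvg_lim => //.
apply: cvg_trans (cvg_at_right_filter (@continuous_horner _ q^`(k) c)).
apply: near_eq_cvg; near=> y; apply/esym/(derive1n_eq_poly wq).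
by rewrite in_itv/=; apply/andP; split; near: y; [exact: nbhs_right_gt|exact: nbhs_right_lt].
Unshelve. all: by end_near. Qed.

Lemma left_deriv_eq_poly c d w q k : c < d ->
  {in `]c, d[, forall x, w x = q.[x]} -> left_deriv w k d = (q^`(k)).[d].
Proof.
move=> cd wq; apply: cvg_lim => //.
apply: cvg_trans (cvg_at_left_filter (@continuous_horner _ q^`(k) d)).
apply: near_eq_cvg; near=> y; apply/esym/(derive1n_eq_poly wq).
by rewrite in_itv/=; apply/andP; split; near: y; [exact: nbhs_left_gt|exact: nbhs_left_lt].
Unshelve. all: by end_near. Qed.

(** If [S] is an antiderivative of [s], then S(h x + m) / h is one of s(h x + m), so both sides are
    the same difference of values of [S]. *)
Lemma Rintegral_comp_affine a b h m s : 0 < h -> a <= b ->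
  \int[mu]_(x in `]a, b[) s.[h * x + m] =
  h^-1 * \int[mu]_(x in `](h * a + m), (h * b + m)[) s.[x].
Proof.
move=> h0 ab; have [S _ <-] := poly_antiderivative s.
rewrite Rintegral_deriv_poly ?lerD2r ?ler_pM2l//.
pose A : {poly R} := h *: 'X + m%:P.
have AE x : A.[x] = h * x + m by rewrite !hornerE.
have dA : A^`() = h%:P by rewrite derivD derivC derivZ derivX addr0 alg_polyC.
rewrite -!AE -!horner_comp mulrBr -!hornerZ -Rintegral_deriv_poly//.
apply: eq_Rintegral => x _.
rewrite derivZ deriv_comp dA hornerZ hornerM hornerC horner_comp AE.
by rewrite mulrCA mulVf ?mulr1// gt_eqF.
Qed.

Lemma Q_ge0 p (D : 'I_p.+1 -> R) : 0 <= Q D.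
Proof.
rewrite /Q; apply: lb_le_inf; last by move=> _ [v _ ->]; rewrite addr_ge0// sqr_ge0.
by exists (L2norm (- 2^-1) 0 (horner (0 + jump_poly D)) ^+ 2
      + L2norm 0 2^-1 (horner (0 - jump_poly D)) ^+ 2); exists 0; rewrite ?size_poly0.
Qed.

Lemma Q_le p (D : 'I_p.+1 -> R) (v : {poly R}) : (size v <= p.+1)%N ->
  Q D <= \int[mu]_(x in `](- 2^-1), 0[) (v + jump_poly D).[x] ^+ 2
       + \int[mu]_(x in `]0, 2^-1[) (v - jump_poly D).[x] ^+ 2.
Proof.
move=> vp; apply: ge_inf.
  by exists 0 => _ [t _ ->]; rewrite addr_ge0// sqr_ge0.
exists v => //; rewrite !L2normE !sqr_sqrtr//.
- by apply: Rintegral_ge0 => x _; exact: sqr_ge0.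
- by apply: Rintegral_ge0 => x _; exact: sqr_ge0.
Qed.

(** Taylor expansion of T(h x + m) at [m]: its factor h^k equals h^(p+1) / h^(p+1-k), the scaling
    built into the jumps. *)
Lemma jump_poly_taylor p h m (T : {poly R}) (D : 'I_p.+1 -> R) x : 0 < h ->
  (size T <= p.+1)%N ->
  (forall k : 'I_p.+1, D k = (T^`(k)).[m] / h ^+ (p.+1 - k)) ->
  h ^+ p.+1 * (jump_poly D).[x] = 2^-1 * T.[h * x + m].
Proof.
move=> h0 sT hD; rewrite /jump_poly hornerZ mulrCA; congr (_ * _).
rewrite [h * x + m]addrC (nderiv_taylor_wide (mulrC _ _) sT) horner_sum mulr_sumr.
apply: eq_bigr => k _; rewrite hornerZ hornerXn hD nderivn_def hornerMn exprMn.
rewrite -{1}(subnK (ltnW (ltn_ord k))) exprD -mulr_natr.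
have f0 : (k`!%:R : R) != 0 by rewrite pnatr_eq0 -lt0n fact_gt0.
have hk : h ^+ (p.+1 - k) != 0 by rewrite expf_neq0// gt_eqF.
by field; rewrite hk f0.
Qed.

(** With T = qp - qm and avg = (qp + qm)/2, one has v - qm = (v - avg) + T/2 and v - qp = (v - avg)
    - T/2. The rescaled v - avg is thus a competitor in the infimum [Q], T/2 being the rescaled
    [jump_poly]. *)
Lemma scaled_Q_le p h m (qm qp v : {poly R}) (D : 'I_p.+1 -> R) : 0 < h ->
  (size qm <= p.+1)%N -> (size qp <= p.+1)%N -> (size v <= p.+1)%N ->
  (forall k : 'I_p.+1,
    D k = ((qp^`(k)).[m] - (qm^`(k)).[m]) / h ^+ (p.+1 - k)) ->
  (h ^+ p.+1) ^+ 2 * (h * Q D) <=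
    \int[mu]_(x in `](m - h / 2), m[) (qm - v).[x] ^+ 2 +
    \int[mu]_(x in `]m, (m + h / 2)[) (qp - v).[x] ^+ 2.
Proof.
move=> h0 sm sp sv hD; set H := h ^+ p.+1.
have H0 : H != 0 by rewrite expf_neq0// gt_eqF.
pose A : {poly R} := h *: 'X + m%:P.
have AE x : A.[x] = h * x + m by rewrite !hornerE.
have sizeB (s t : {poly R}) : (size s <= p.+1)%N -> (size t <= p.+1)%N ->
    (size (s - t)%R <= p.+1)%N.
  by move=> ? ?; rewrite (leq_trans (size_polyD _ _))// size_polyN geq_max; apply/andP.
pose T := qp - qm; pose avg := 2^-1 *: (qp + qm).
have hJ x : H * (jump_poly D).[x] = 2^-1 * T.[h * x + m].
  apply: jump_poly_taylor => //; first exact: sizeB.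
  by move=> k; rewrite hD /T derivnB hornerD hornerN.
pose V := H^-1 *: ((v - avg) \Po A).
have sV : (size V <= p.+1)%N.
  rewrite (leq_trans (size_scale_leq _ _))// size_comp_poly2.
    apply: sizeB => //; rewrite (leq_trans (size_scale_leq _ _))//.
    by rewrite (leq_trans (size_polyD _ _))// geq_max sp sm.
  rewrite /A size_polyDl size_scale ?gt_eqF// size_polyX//.
  by rewrite (leq_ltn_trans (size_polyC_leq1 _)).
have hV x : H * V.[x] = (v - avg).[h * x + m].
  by rewrite hornerZ mulVKf// horner_comp AE.
have e1 x : H ^+ 2 * (V + jump_poly D).[x] ^+ 2 = ((qm - v) ^+ 2).[h * x + m].
  rewrite -exprMn hornerD mulrDr hV hJ horner_exp /T /avg !hornerD !hornerN !hornerZ !hornerD.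
  by field.
have e2 x : H ^+ 2 * (V - jump_poly D).[x] ^+ 2 = ((qp - v) ^+ 2).[h * x + m].
  rewrite -exprMn hornerD hornerN mulrBr hV hJ horner_exp /T /avg !hornerD !hornerN !hornerZ !hornerD.
  by field.
have c s : continuous (fun x : R => s.[x] ^+ 2) by exact: continuous_sqr_horner.
have : H ^+ 2 * Q D <= H ^+ 2 * (\int[mu]_(x in `](- 2^-1), 0[) (V + jump_poly D).[x] ^+ 2
       + \int[mu]_(x in `]0, 2^-1[) (V - jump_poly D).[x] ^+ 2).
  by rewrite ler_wpM2l ?sqr_ge0// Q_le.
rewrite mulrDr -!RintegralZl//; try exact: continuous_integrable_oo.
under eq_Rintegral do rewrite e1.
under [X in _ + X]eq_Rintegral do rewrite e2.
have i2 : 0 <= 2^-1 :> R by rewrite invr_ge0.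
have i2N : - 2^-1 <= 0 :> R by rewrite oppr_le0.
(* The substitution contributes 1/h on each half, whence the factor [h] in front of [Q]. *)
rewrite !Rintegral_comp_affine// mulr0 add0r -mulrDr [_^-1 * (_ + _)]mulrC ler_pdivlMr//.
have -> : h * - 2^-1 + m = m - h / 2 by ring.
have -> : h / 2 + m = m + h / 2 by ring.
rewrite -mulrA [Q D * h]mulrC.
under eq_Rintegral do rewrite horner_exp.
by under [X in _ + X]eq_Rintegral do rewrite horner_exp.
Qed.

End bridge.

(** * The lower bound on the whole interval *)

Section interval.
Context {R : realType}.
Notation mu := (@lebesgue_measure R).
Implicit Types (a b c h m : R) (s q : {poly R}) (f g u w : R -> R).

(** Around a point outside ]a, b[ the strict inclusions leave an open interval on which [phi] agrees
    with the polynomial 0. *)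
Lemma derive1n_vanishes_off a b c d k phi : a < c -> d < b ->
  vanishes_off c d phi -> vanishes_off a b (derive1n k phi).
Proof.
move=> ac db vphi x; rewrite in_itv/= negb_and -!leNgt => /orP[xa|bx].
- rewrite (@derive1n_eq_poly _ (x - 1) c phi 0) ?derivn0 ?horner0//.
  + by rewrite linear0 horner0.
  + move=> y; rewrite in_itv/= => /andP[_ yc].
    by rewrite horner0 vphi// in_itv/= ltNge (ltW yc).
  + by rewrite in_itv/= (le_lt_trans xa ac) ltrBlDr ltrDl ltr01.
- rewrite (@derive1n_eq_poly _ d (x + 1) phi 0).
  + by rewrite linear0 horner0.
  + move=> y; rewrite in_itv/= => /andP[dy _].
    by rewrite horner0 vphi// in_itv/= [y < d]ltNge (ltW dy) andbF.
  + by rewrite in_itv/= (lt_le_trans db bx) ltrDl ltr01.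
Qed.

Lemma vanishes_off_test_function a b c d phi : a < c -> d < b ->
  smooth phi -> vanishes_off c d phi -> test_function a b phi.
Proof.
move=> ac db sphi vphi.
have sub : closure [set x | phi x != 0] `<=` `[c, d].
  rewrite (closure_id `[c, d]).1; last exact: itv_closed.
  apply: closureS => x /= phix; apply: subset_itv_oo_cc => /=.
  by apply: contraNT phix => /vphi ->.
split => //.
- apply: (subclosed_compact _ (@segment_compact _ c d)) => //.
  exact: closed_closure.
- apply: subset_trans sub _; apply: subset_itv; rewrite bnd_simp//.
Qed.

Lemma sqint_piecewise a b p N w : a < b -> (0 < N)%N ->
  piecewise_poly a b p N w -> sqint `]a, b[ w.
Proof.
move=> ab N0 pw.
have h0 : 0 < mesh a b N by rewrite divr_gt0 ?subr_gt0// ltr0n.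
have nodeS k : node a b N k.+1 = node a b N k + mesh a b N.
  by rewrite /node -natr1 mulrDl mul1r addrA.
have -> : b = node a b N N.
  by rewrite /node mulrC divfK ?pnatr_eq0 -?lt0n// addrC subrK.
(* Induction over the cells, each taken with its right node; a node is a null set, so the arbitrary
   value of [w] there is harmless. *)
suff H k : (k <= N)%N -> a <= node a b N k /\ sqint `]a, (node a b N k)] w.
  have [_] := H N (leqnn N); apply: sqintS => //.
  by apply: subset_itvl; rewrite bnd_simp.
elim: k => [_|k IH kN].
  rewrite /node mul0r addr0 set_itvoc0; split => //; split.
    exact: measurable_fun_set0.
  exact: integrable_set0.
have [ak sk] := IH (ltnW kN); split; first by rewrite nodeS ler_wpDr// ltW.
have [q _ wq] := pw k kN.
set x := node a b N k in ak sk wq *; set y := node a b N k.+1 in wq *.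
have xy : x < y by rewrite /y nodeS ltrDl.
rewrite (@itv_bndbnd_setU _ _ (BRight a) (BRight x) (BRight y)) ?bnd_simp//; last exact: ltW.
rewrite -(@setUitv1 _ _ (BRight x) y true) ?bnd_simp//.
have mU : measurable (`]x, y[ `|` [set y]) by exact: measurableU.
apply: sqintU => //; apply: sqintU => //.
- apply: (eq_sqint _ _ (sqint_continuous x y (@continuous_horner _ q))) => //.
  by move=> z; rewrite inE/= => /wq ->.
- split; first exact: measurable_fun_set1.
  apply: null_set_integrable => //; first exact: measurable_fun_set1.
  exact: lebesgue_measure_set1.
Qed.

(** Triangle inequality in the plane for the vectors with coordinates the roots of (X, x) and of (Y,
    y). The cross terms reduce to 2 sqrt(Xy) sqrt(xY) <= Xy + xY. It accumulates the cells one at a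
    time in the theorem. *)
Lemma minkowski_step (X Y x y : R) : 0 <= X -> 0 <= Y -> 0 <= x -> 0 <= y ->
  (Num.sqrt X + Num.sqrt Y) ^+ 2 + (Num.sqrt x + Num.sqrt y) ^+ 2 <=
  (Num.sqrt (X + x) + Num.sqrt (Y + y)) ^+ 2.
Proof.
move=> X0 Y0 x0 y0; have Xx : 0 <= X + x by exact: addr_ge0.
have Yy : 0 <= Y + y by exact: addr_ge0.
rewrite !sqrrD !sqr_sqrtr// -!sqrtrM//.
suff : Num.sqrt (X * Y) + Num.sqrt (x * y) <= Num.sqrt ((X + x) * (Y + y)) by lra.
have A0 : 0 <= Num.sqrt (X * Y) + Num.sqrt (x * y) by rewrite addr_ge0 ?sqrtr_ge0.
rewrite -[leLHS]ger0_norm// -sqrtr_sqr ler_wsqrtr//.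
rewrite sqrrD !sqr_sqrtr ?mulr_ge0// -sqrtrM ?mulr_ge0//.
suff : Num.sqrt (X * Y * (x * y)) *+ 2 <= X * y + x * Y by lra.
have -> : X * Y * (x * y) = (X * y) * (x * Y) by ring.
rewrite sqrtrM ?mulr_ge0//.
have := sqr_ge0 (Num.sqrt (X * y) - Num.sqrt (x * Y)).
by rewrite sqrrB !sqr_sqrtr ?mulr_ge0//; lra.
Qed.


(** [cell_lower_bound] on the cell centred at the node, with B = h^(p+1) sqrt(h Q); [scaled_Q_le]
    says that this [B] is admissible. *)
Lemma node_jump_lower_bound a b p N u w g i : a < b -> (0 < N)%N ->
  L2 a b u -> weak_derivatives a b p.+1 u g -> piecewise_poly a b p N w ->
  (0 < i < N)%N ->
  forall h m, h = mesh a b N -> m = node a b N i ->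
  h ^+ p.+1 * Num.sqrt (h * Q (fun k : 'I_p.+1 => scaled_jump a b p N w i k)) <=
  Num.sqrt (\int[mu]_(x in `](m - h / 2), (m + h / 2)[) (u x - w x) ^+ 2) +
  h ^+ p.+1 * Num.sqrt (\int[mu]_(x in `](m - h / 2), (m + h / 2)[) g x ^+ 2).
Proof.
move=> ab N0 /L2_sqint su [/L2_sqint sg weak] pw /andP[i0 iN] _ _ -> ->.
set h := mesh a b N; set m := node a b N i.
set I := `](m - h / 2), (m + h / 2)[%classic.
have sw := sqint_piecewise ab N0 pw.
have h0 : 0 < h by rewrite divr_gt0 ?subr_gt0// ltr0n.
have nodeS k : node a b N k.+1 = node a b N k + h.
  by rewrite /node -natr1 mulrDl mul1r addrA.
have bE : b = a + N%:R * h.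
  by rewrite /h /mesh mulrC divfK ?pnatr_eq0 -?lt0n// addrC subrK.
have am : a + h <= m.
  by rewrite /m /node lerD2l -[leLHS]mul1r ler_wpM2r ?ler1n// ltW.
have mb : m + h <= b.
  rewrite bE /m /node -addrA lerD2l -[X in _ + X]mul1r -mulrDl ler_wpM2r//; first exact: ltW.
  by rewrite natr1 ler_nat.
have [qm sm wm] := pw i.-1 (leq_ltn_trans (leq_pred i) iN).
have [qp sp wp] := pw i iN.
have im : node a b N i.-1 = m - h.
  by have := nodeS i.-1; rewrite prednK// -/m => ->; rewrite addrK.
rewrite im prednK// -/m in wm; rewrite nodeS -/m in wp.
have mhm : m - h < m by rewrite ltrBlDr ltrDl.
have mmh : m < m + h by rewrite ltrDl.
pose D (k : 'I_p.+1) := scaled_jump a b p N w i k.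
have DE (k : 'I_p.+1) : D k = ((qp^`(k)).[m] - (qm^`(k)).[m]) / h ^+ (p.+1 - k).
  by rewrite /D /scaled_jump /jump (right_deriv_eq_poly k mmh wp) (left_deriv_eq_poly k mhm wm).
have subI : I `<=` `]a, b[%classic.
  by apply: subset_itv; rewrite bnd_simp; lra.
have hp0 : 0 <= h ^+ p.+1 by rewrite exprn_ge0// ltW.
have hQ0 : 0 <= h * Q D by rewrite mulr_ge0 ?Q_ge0// ltW.
have := @cell_lower_bound R (m - h / 2) m (m + h / 2) p.+1 qm qp u w g
  (h ^+ p.+1 * Num.sqrt (h * Q D)).
have -> : m + h / 2 - (m - h / 2) = h by field.
apply=> //.
- by lra.
- by lra.
- by move=> x; rewrite in_itv/= => /andP[x1 x2]; apply: wm; rewrite in_itv/= x2 andbT; lra.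
- by move=> x; rewrite in_itv/= => /andP[x1 x2]; apply: wp; rewrite in_itv/= x1/=; lra.
- exact: sqintS su.
- exact: sqintS sw.
- exact: sqintS sg.
- move=> c d phi lc cd dr sphi vphi.
  have ac : a < c by lra.
  have db : d < b by lra.
  have := weak phi (vanishes_off_test_function ac db sphi vphi).
  (* The weak derivative identity on ]a, b[ localizes to the cell, off which [phi] and its
     derivatives vanish. *)
  rewrite (@Rintegral_vanishes_off _ a b (m - h / 2) (m + h / 2)); first last.
  + move=> x xI; rewrite (@derive1n_vanishes_off (m - h / 2) (m + h / 2) c d)// ?mulr0//.
  + by lra.
  + by lra.
  move=> ->; congr (_ * _); apply: Rintegral_vanishes_off; [by lra|by lra|].
  by move=> x xI; rewrite (vanishes_offW _ _ vphi xI) ?mulr0// ltW.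
- by rewrite mulr_ge0 ?sqrtr_ge0.
- by move=> v sv; rewrite exprMn sqr_sqrtr//; exact: scaled_Q_le.
Qed.

End interval.

Theorem theorem2p3 (R : realType) (a b : R) (hab : a < b) (p : nat) :
  exists2 C2 : R, 0 < C2 &
    forall (N : nat) (hN : (0 < N)%N) (u uR : R -> R),
      sobolevH a b p.+1 u ->
      piecewise_poly a b p N uR ->
      L2norm a b (u \- uR) >=
        mesh a b N ^+ p.+1 *
          (Num.sqrt (\sum_(1 <= i < N)
              mesh a b N *
                Q (fun k : 'I_p.+1 => scaled_jump a b p N uR i k))
           - C2 * sobolev_seminorm a b p.+1 u).
Proof.
(* The cell bound carries the factor 1 on the norm of the derivative, and the summation preserves
   it. *)
exists 1; first exact: ltr01.
move=> N N0 u w [u2 ud] pw; rewrite mul1r.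
have [g0 wg0] := ud p.+1 (leqnn _).
(* The [xget] in the seminorm does not fall back on its default, as u in H^(p+1) provides a weak
   derivative. *)
have wg : weak_derivatives a b p.+1 u (weak_derivative a b p.+1 u).
  exact: (xgetPex (cst 0) (ex_intro _ g0 wg0)).
rewrite /sobolev_seminorm; move: (weak_derivative _ _ _ _) wg => g wg {g0 wg0 ud}.
have key i := node_jump_lower_bound hab N0 u2 wg pw (i := i).
have su := L2_sqint u2; have [/L2_sqint sg _] := wg.
have sw := sqint_piecewise hab N0 pw.
have suw := sqintB (measurable_itv _) su sw.
rewrite !L2normE; set mu := lebesgue_measure.
set h := mesh a b N; set H := h ^+ p.+1.
have h0 : 0 < h by rewrite divr_gt0 ?subr_gt0// ltr0n.
have hge0 : 0 <= h by exact: ltW.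
have H0 : 0 <= H by rewrite exprn_ge0// ltW.
have bE : b = a + N%:R * h.
  by rewrite /h /mesh mulrC divfK ?pnatr_eq0 -?lt0n// addrC subrK.
pose Qi i := h * Q (fun k : 'I_p.+1 => scaled_jump a b p N w i k).
have Qi0 i : 0 <= Qi i by rewrite mulr_ge0 ?Q_ge0// ltW.
have S0 k : 0 <= \sum_(1 <= i < k) Qi i by apply: sumr_ge0.
(* Midpoints x_k - h/2: the cell centred at x_k is ]c k, c (k+1)[. Together the cells fill ]c 1, c
   N[, leaving half a mesh at each end of ]a, b[. *)
pose c (k : nat) := a + (k%:R - 1 / 2) * h.
have cS k : c k.+1 = c k + h by rewrite /c -natr1; ring.
pose E f k := \int[mu]_(x in `](c 1%N), (c k)[) f x ^+ 2.
have E0 f k : 0 <= E f k by apply: Rintegral_ge0 => x _; exact: sqr_ge0.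
have ac1 : a <= c 1%N by rewrite /c lerDl mulr_ge0//; lra.
have c1c k : (0 < k)%N -> c 1%N <= c k.
  by move=> k0; rewrite /c lerD2l ler_wpM2r// lerB// ler1n.
have ckb k : (k <= N)%N -> c k <= b.
  move=> kN; rewrite bE /c lerD2l ler_wpM2r//.
  have : k%:R <= N%:R :> R by rewrite ler_nat.
  by lra.
have Esplit f k : (0 < k < N)%N -> sqint `]a, b[ f ->
    E f k.+1 = E f k + \int[mu]_(x in `](c k), (c k.+1)[) f x ^+ 2.
  move=> /andP[k0 kN] [_ If]; apply: Rintegral_oo_split; rewrite ?c1c//.
    by rewrite cS lerDl.
  apply: integrableS If => //; apply: subset_itv; rewrite bnd_simp//.
  exact: ckb.
(* Minkowski over the first k - 1 cells, by induction: the squared cell bound is added and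
   [minkowski_step] merges the norms. *)
have main k : (0 < k <= N)%N -> H ^+ 2 * \sum_(1 <= i < k) Qi i <=
    (Num.sqrt (E (u \- w) k) + H * Num.sqrt (E g k)) ^+ 2.
  elim: k => [//|[|k] IH] /andP[_ kN].
    by rewrite big_geq// mulr0 sqr_ge0.
  have kN' : (0 < k.+1 < N)%N by [].
  rewrite big_nat_recr//= mulrDr (Esplit _ _ kN' suw) (Esplit _ _ kN' sg).
  set X := E (u \- w) _; set Y := E g _; set x := Rintegral _ _ _; set y := Rintegral _ _ _.
  have x0 : 0 <= x by apply: Rintegral_ge0 => z _; exact: sqr_ge0.
  have y0 : 0 <= y by apply: Rintegral_ge0 => z _; exact: sqr_ge0.
  have HS t : H * Num.sqrt t = Num.sqrt (H ^+ 2 * t).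
    by rewrite sqrtrM ?sqr_ge0// sqrtr_sqr ger0_norm.
  have H20 : 0 <= H ^+ 2 by exact: sqr_ge0.
  rewrite HS mulrDr.
  apply: le_trans (minkowski_step (E0 _ _) (mulr_ge0 H20 (E0 _ _)) x0 (mulr_ge0 H20 y0)).
  rewrite -!HS; apply: lerD; first exact: (IH (ltnW kN)).
  have := key k.+1 kN' _ _ erefl erefl.
  have -> : node a b N k.+1 - mesh a b N / 2 = c k.+1 by rewrite /node /c -/h; field.
  have -> : node a b N k.+1 + mesh a b N / 2 = c k.+2.
    by rewrite cS /node /c -/h; field.
  rewrite -/h -/H -[h * Q _]/(Qi k.+1) => hk.
  rewrite -[Qi k.+1]sqr_sqrtr// -exprMn ler_sqr ?nnegrE//.
    by rewrite mulr_ge0// sqrtr_ge0.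
  by rewrite addr_ge0 ?mulr_ge0 ?sqrtr_ge0.
have := main N; rewrite N0 leqnn => /(_ isT).
rewrite -[X in _ * X <= _]sqr_sqrtr// -exprMn.
rewrite ler_sqr ?nnegrE ?addr_ge0 ?mulr_ge0 ?sqrtr_ge0// => hfin.
have mono f : sqint `]a, b[ f -> E f N <= \int[mu]_(x in `]a, b[) f x ^+ 2.
  move=> [_ If]; apply: subset_Rintegral => //.
    by apply: subset_itv; rewrite bnd_simp// ckb.
  by move=> x _; exact: sqr_ge0.
rewrite mulrBr lerBlDr; apply: (le_trans hfin); apply: lerD.
  by rewrite ler_wsqrtr// mono.
by rewrite ler_wpM2l// ler_wsqrtr// mono.
Qed.
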